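(* There is a uniform algebra $A$ on a compact metric space such that every point of $\Phi_A$ is a one-point Gleason part and such that the invertible elements are dense in $A$, but $\Gamma_A \neq \Phi_A$.
   Context: A uniform algebra on a non-empty compact Hausdorff space $X$ is a uniformly closed, unital subalgebra of $C(X)$ (the continuous complex-valued functions on $X$) that separates the points of $X$; it is a Banach algebra with respect to the uniform norm. $\Phi_A$ is the maximal ideal space (character space, with the Gelfand topology) of $A$. The Shilov boundary $\Gamma_A$ is the minimum non-empty closed subset $K$ of $X$ such that $\sup_K |f| = \sup_X |f|$ for all $f \in A$; it is regarded as a subset of $\Phi_A$ by identifying points of $X$ with their evaluation characters. The Gleason parts of $A$ are the equivalence classes in $\Phi_A$ for the equivalence relation $\varphi \sim \psi \iff \|\varphi - \psi\| < 2$, where $\|\cdot\|$ is the norm of the dual space of $A$. A point $\varphi \in \Phi_A$ is a one-point Gleason part if its equivalence class is $\{\varphi\}$, i.e. $\|\varphi - \psi\| = 2$ for all $\psi \in \Phi_A \setminus \{\varphi\}$. *)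

(* Defs.v *)
From HB Require Import structures.
From mathcomp Require Import all_boot all_order all_algebra.
From mathcomp Require Import complex.
From mathcomp Require Import all_classical all_reals all_analysis.

Set Implicit Arguments.
Unset Strict Implicit.
Unset Printing Implicit Defensive.

Import Order.TTheory GRing.Theory Num.Theory.
Import numFieldNormedType.Exports.

Local Open Scope classical_set_scope.
Local Open Scope ring_scope.
Local Open Scope complex_scope.

(* The complex numbers are written R[i]^o: the ^o tag gives R[i] the topology
   of its modulus and makes it a module over itself rather than over R. *)

(* X is meant to be non-empty, compact and Hausdorff; uniform algebras are used
   under these hypotheses on X. *)
Record uniform_algebra (R : realType) (X : topologicalType) := UniformAlgebra {
  ua_pred :> {pred X -> R[i]^o};
  ua_one : 1 \in ua_pred;
  ua_linear : GRing.linear_closed ua_pred;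
  ua_mul : GRing.mulr_2closed ua_pred;
  ua_continuous : forall f : X -> R[i]^o, f \in ua_pred -> continuous f;
  ua_separates : forall x y : X, x <> y -> exists2 f, f \in ua_pred & f x <> f y;
  ua_closed : closed ([set f | f \in ua_pred] : set {uniform X -> R[i]^o})
}.

Section UniformAlgebraType.
Variables (R : realType) (X : topologicalType).

Lemma ua_subring (A : uniform_algebra R X) : subring_closed (ua_pred A).
Proof.
split; [exact: ua_one| |exact: ua_mul].
by move=> f g Af Ag; rewrite addrC -scaleN1r; apply: ua_linear.
Qed.
HB.instance Definition _ (A : uniform_algebra R X) :=
  GRing.isSubringClosed.Build (X -> R[i]^o) (ua_pred A) (@ua_subring A).

Lemma ua_scaler (A : uniform_algebra R X) : GRing.scaler_closed (ua_pred A).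
Proof.
move=> a f Af; rewrite -[a *: f]addr0; apply: ua_linear => //; exact: rpred0.
Qed.
HB.instance Definition _ (A : uniform_algebra R X) :=
  GRing.isScaleClosed.Build R[i] (X -> R[i]^o) (ua_pred A) (@ua_scaler A).

(* The elements of A as a commutative C-algebra, with the topology of the
   uniform norm. *)
Record ua_type (A : uniform_algebra R X) :=
  UAType { ua_val :> X -> R[i]^o; _ : ua_val \in ua_pred A }.

Variable A : uniform_algebra R X.
HB.instance Definition _ := [isSub for @ua_val A].
HB.instance Definition _ := [Choice of ua_type A by <:].
HB.instance Definition _ :=
  GRing.SubChoice_isSubComPzRing.Build _ _ (ua_type A) (@ua_subring A).
HB.instance Definition _ := [SubZmodule_isSubLmodule of ua_type A by <:].
HB.instance Definition _ := Uniform.copy (ua_type A)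
  (initial_topology (@ua_val A : ua_type A -> {uniform X -> R[i]^o})).
End UniformAlgebraType.

Section Characters.
Variables (R : realType) (X : topologicalType) (A : uniform_algebra R X).

Definition sup_norm (K : set X) (f : X -> R[i]^o) : \bar R :=
  ereal_sup [set (Normc.normc (f x))%:E | x in K].

Definition invertible : set (ua_type A) := [set f | exists g, f * g = 1].

(* The Gelfand topology plays no role below, so the maximal ideal space is just
   a set of functionals on A. *)
Definition character_space : set (ua_type A -> R[i]^o) :=
  [set phi : ua_type A -> R[i]^o |
    [/\ scalar phi, {morph phi : f g / f * g} & phi <> 0]].

(* Taken in \bar R so that no boundedness of L is presupposed. *)
Definition dual_norm (L : ua_type A -> R[i]^o) : \bar R :=
  ereal_sup [set (Normc.normc (L f))%:E |
             f in [set f : ua_type A | (sup_norm setT f <= 1%:E)%E]].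

Definition gleason_part (phi : ua_type A -> R[i]^o) : set (ua_type A -> R[i]^o) :=
  [set psi | character_space psi /\ (dual_norm (phi - psi)%R < 2%:E)%E].

Definition evaluation (x : X) : ua_type A -> R[i]^o := fun f => f x.

Lemma evaluation_character (x : X) : character_space (evaluation x).
Proof.
split=> // /(congr1 (fun phi => phi 1)) /eqP.
by rewrite /evaluation /= oner_eq0.
Qed.

Definition is_boundary (K : set X) : Prop :=
  [/\ closed K, K !=set0 &
      forall f : ua_type A, sup_norm K f = sup_norm setT f].

(* A subset of X; its copy in the character space is its image by evaluation. *)
Definition is_shilov_boundary (G : set X) : Prop :=
  is_boundary G /\ forall K, is_boundary K -> G `<=` K.
End Characters.

Arguments character_space {R X} A _.
Arguments invertible {R X} A _.
Arguments gleason_part {R X} A phi _.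
Arguments is_boundary {R X} A K.
Arguments is_shilov_boundary {R X} A G.
Arguments evaluation {R X} A x _.

(* Main.v *)
Require Import Defs.
From HB Require Import structures.
From mathcomp Require Import all_boot all_order all_algebra.
From mathcomp Require Import complex.
From mathcomp Require Import ring lra.
From mathcomp Require Import all_classical all_reals all_analysis.

Set Implicit Arguments.
Unset Strict Implicit.
Unset Printing Implicit Defensive.

Import Order.TTheory GRing.Theory Num.Theory.
Import numFieldNormedType.Exports.

Local Open Scope classical_set_scope.
Local Open Scope ring_scope.

(* Let p_j be a dense sequence of polynomials in two variables with
   p_j(0) <> 0.  For suitable e_j > 0 the point 0 lies in the hull of
   K = { x in the boundary of the bidisc : |p_j x| >= e_j for all j } with respect
   to the algebra generated by the polynomials and the 1 / p_j.  Indeed, if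
   |P(0)/D(0)| exceeded the maximum of |P/D| on K, then the curve
   P = (P(0)/D(0)) D through 0 would meet the boundary of the bidisc only where
   some |p_j| < e_j; the e_j are chosen so that some product of powers of the p_j
   is smaller there than at 0, which contradicts the maximum principle on curves.
   The closed algebra generated in this way has dense invertible group since the
   p_j are dense.

   Following Cole, one then adjoins square roots of everything: a point of the
   space is a consistent valuation of all formal terms built from the two
   coordinates, the 1 / p_j and square roots.  Averaging over the two signs of a
   square root shows that all points over 0 stay in the hull, so that the Shilov
   boundary, which lies over the boundary of the bidisc, is proper.  Adjoining a
   square root preserves the density of invertible elements (perturb s in the norm
   s^2 - b^2 f of s + b sqrt f), and the density of squares forces all Gleason
   parts to be singletons. *)

(** Two variables are essential: P = (P(0)/D(0)) D then cuts out a curve that reaches the boundary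
    of the bidisc, whereas in one variable it is in general a finite set. The curve may be singular,
    so its maximum principle is proved without a parametrization: the term e |x|^2 bounds the real
    part of a polynomial L by a negative quadratic near an interior maximum, while elimination
    produces nearby points where L is a small positive number.

    The e_j must be fixed before P and D are known. On a given curve only the first n conditions
    |p_j| >= e_j are enforced at a time, and compactness yields a point that satisfies all of them.

    Dense squares act on arbitrary characters phi, psi: the supremum m of |phi g| over the unit ball
    of the kernel of psi satisfies m <= m^2, hence m = 1, and Moebius transforms then bring the
    distance up to 2. So Phi_A is never computed, and one evaluation over 0 is enough to show that
    it exceeds the Shilov boundary. *)

(** * Elimination of one variable by characteristic polynomials *)

Section Eliminant.
Variable C : closedFieldType.

(** Spectral mapping. For the direct implication p - a is split into linear factors; their product
    at A kills the eigenvector v, and the first factor that kills the running vector exhibits an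
    eigenvector of A. *)
Lemma eigenvalue_horner_mx n (A : 'M[C]_n.+1) (p : {poly C}) (a : C) :
  eigenvalue (horner_mx A p) a <-> exists2 w, eigenvalue A w & p.[w] = a.
Proof.
split; last first.
  move=> [w /eigenvalueP[v Av v0] <-]; apply/eigenvalueP; exists v => //.
  elim/poly_ind: p => [|p c IH]; first by rewrite rmorph0 mulmx0 horner0 scale0r.
  rewrite rmorphD rmorphM /= horner_mx_X horner_mx_C mulmxDr -mulmxE mulmxA.
  by rewrite IH -scalemxAl Av mul_mx_scalar hornerMXaddC scalerA -scalerDl.
move=> /eigenvalueP[v Av v0].
have [rs] := closed_field_poly_normal (p - a%:P).
(* If p is the constant a, any eigenvalue of A will do, and one exists since the characteristic
   polynomial is not constant. *)
have [/eqP|cn0] := eqVneq (lead_coef (p - a%:P)) 0.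
  rewrite lead_coef_eq0 subr_eq0 => /eqP -> _.
  have /closed_rootP[w] : size (char_poly A) != 1 by rewrite size_char_poly.
  by rewrite -eigenvalue_root_char; exists w; rewrite ?hornerC.
move: (lead_coef _) cn0 => c cn0 pE.
have : v *m horner_mx A (\prod_(z <- rs) ('X - z%:P)) = 0.
  apply: (scalerI cn0); rewrite scaler0 scalemxAr -linearZ /= -pE.
  by rewrite rmorphB /= horner_mx_C mulmxBr Av mul_mx_scalar subrr.
have {pE} : {in rs, forall z, p.[z] = a}.
  move=> z zrs; apply/eqP; rewrite -subr_eq0 -[in X in _ - X](hornerC a z).
  rewrite -hornerN -hornerD pE hornerZ.
  by have := root_prod_XsubC rs z; rewrite zrs => /eqP ->; rewrite mulr0.
elim: rs v v0 {Av} => [|z rs IH] v v0 prs.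
  by rewrite big_nil rmorph1 mulmx1 => ve; rewrite ve eqxx in v0.
rewrite big_cons rmorphM /= -mulmxE mulmxA.
have [vz _|vz /IH] := eqVneq (v *m horner_mx A ('X - z%:P)) 0.
  exists z; last by apply: prs; rewrite mem_head.
  apply/eigenvalueP; exists v => //; apply/eqP; rewrite -subr_eq0 -vz.
  by rewrite rmorphB /= horner_mx_X horner_mx_C mulmxBr mul_mx_scalar.
by apply=> // y yrs; apply: prs; rewrite in_cons yrs orbT.
Qed.

(* A polynomial in (z, w) is an element of {poly {poly C}} with outer variable w:
   its value at (z, w) is q.[w%:P].[z]. *)
Lemma monic_eliminant (q L : {poly {poly C}}) : q \is monic -> (1 < size q)%N ->
  exists N : {poly {poly C}}, forall z m,
    N.[m%:P].[z] = 0 <-> exists w, q.[w%:P].[z] = 0 /\ L.[w%:P].[z] = m.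
Proof.
move=> mq sq.
have [n [M Mq]] : exists n (M : 'M[{poly C}]_n.+1), char_poly M = q.
  have := companionmxK mq; have := size_char_poly (companionmx q).
  move: (companionmx q); case: (size q).-1 => [|n] M sM Mq; last by exists n, M.
  by rewrite -Mq sM in sq.
(* With M the companion matrix of q, the eigenvalues of L(M) at z are the values L(z, w) at the
   roots w of q(z, .), so this is the resultant of q and L - m in w. *)
exists (char_poly (horner_mx M L)) => z m.
have evE (p : {poly {poly C}}) w :
    p.[w%:P].[z] = (map_poly (horner_eval z) p).[w].
  by rewrite -[in RHS](hornerC w z) -/(horner_eval z _) horner_map.
rewrite evE map_char_poly.
rewrite map_horner_mx; set A := map_mx _ M.
have Aq w : (q.[w%:P].[z] = 0) <-> eigenvalue A w.
  by rewrite eigenvalue_root_char evE -Mq map_char_poly; split => /eqP.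
split=> [/eqP|[w [/Aq Aw Lw]]].
  rewrite -[_ == 0]/(root _ m) -eigenvalue_root_char.
  by move=> /eigenvalue_horner_mx[w /Aq qw Lw]; exists w; split; rewrite // evE.
apply/eqP; rewrite -[_ == 0]/(root _ m) -eigenvalue_root_char.
by apply/eigenvalue_horner_mx; exists w; rewrite -?evE.
Qed.
End Eliminant.

Local Notation nm := Normc.normc.

(** * The real-valued modulus of complex numbers *)

Section Modulus.
Variable R : rcfType.
Implicit Types x y : R[i].

Lemma nm_normE x : `|x| = (nm x)%:C%C.
Proof. by []. Qed.

Lemma nm_ge0 x : 0 <= nm x.
Proof. by case: x => a b; exact: sqrtr_ge0. Qed.

Lemma nm0 : nm (0 : R[i]) = 0. Proof. exact: Normc.normc0. Qed.
Lemma nm1 : nm (1 : R[i]) = 1. Proof. exact: Normc.normc1. Qed.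
Lemma nmM x y : nm (x * y) = nm x * nm y. Proof. exact: Normc.normcM. Qed.
Lemma nmV x : nm x^-1 = (nm x)^-1. Proof. exact: Normc.normcV. Qed.
Lemma nmD x y : nm (x + y) <= nm x + nm y. Proof. exact: le_normcD. Qed.
Lemma nmN x : nm (- x) = nm x. Proof. exact: normcN. Qed.
Lemma nm_dist x y : nm (x - y) = nm (y - x). Proof. by rewrite -nmN opprB. Qed.

Lemma nmX x n : nm (x ^+ n) = nm x ^+ n.
Proof. by elim: n => [|n IH]; rewrite ?nm1 // !exprS nmM IH. Qed.

Lemma nm_eq0 x : (nm x == 0) = (x == 0).
Proof. by apply/eqP/eqP => [/Normc.eq0_normc|->]; rewrite ?nm0. Qed.

Lemma nm_gt0 x : (0 < nm x) = (x != 0).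
Proof. by rewrite lt_neqAle nm_ge0 eq_sym nm_eq0 andbT. Qed.

Lemma nmB x y : nm (x - y) <= nm x + nm y.
Proof. by rewrite -(nmN y) nmD. Qed.

Lemma nm_triangle z x y : nm (x - y) <= nm (x - z) + nm (z - y).
Proof. by rewrite (le_trans _ (nmD _ _)) // addrA subrK. Qed.

Lemma nmB_ge x y : nm x - nm y <= nm (x - y).
Proof. by have := nmD (x - y) y; rewrite subrK; lra. Qed.

Lemma nm_real (a : R) : nm a%:C%C = `|a|.
Proof. by rewrite /= expr0n /= addr0 sqrtr_sqr. Qed.

Lemma nm_sqr x : nm x ^+ 2 = complex.Re x ^+ 2 + complex.Im x ^+ 2.
Proof. by case: x => a b /=; rewrite sqr_sqrtr // addr_ge0 // sqr_ge0. Qed.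

Lemma Re_le_nm x : complex.Re x <= nm x.
Proof.
have [/ltW/le_trans -> //|x0] := ltP (complex.Re x) 0; first exact: nm_ge0.
by rewrite -(@ler_pXn2r _ 2) ?nnegrE ?nm_ge0 // nm_sqr lerDl sqr_ge0.
Qed.

Lemma nm_prod (I : Type) (s : seq I) (F : I -> R[i]) :
  nm (\prod_(i <- s) F i) = \prod_(i <- s) nm (F i).
Proof. by elim: s => [|i s IH]; rewrite ?big_nil ?nm1 // !big_cons nmM IH. Qed.

Lemma nm_sum (I : Type) (s : seq I) (F : I -> R[i]) :
  nm (\sum_(i <- s) F i) <= \sum_(i <- s) nm (F i).
Proof.
elim: s => [|i s IH]; first by rewrite !big_nil nm0.
by rewrite !big_cons (le_trans (nmD _ _)) // lerD2l.
Qed.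

Lemma nm_lt_prod (s : seq R[i]) w r : 0 < r ->
  nm (\prod_(z <- s) (w - z)) < r ^+ size s -> exists2 z, z \in s & nm (w - z) < r.
Proof.
move=> r0; elim: s => [|z s IH]; first by rewrite big_nil nm1 ltxx.
rewrite big_cons nmM exprS.
have [wz _|wz lt_s] := ltP (nm (w - z)) r; first by exists z; rewrite ?mem_head.
have /IH [z' z's wz'] : nm (\prod_(j <- s) (w - j)) < r ^+ size s.
  rewrite -(ltr_pM2l r0); apply: le_lt_trans lt_s.
  by rewrite ler_wpM2r ?nm_ge0.
by exists z'; rewrite // in_cons z's orbT.
Qed.

End Modulus.

(** * Estimates for polynomials in one and two variables *)

Section PolyEstimates.
Variable R : rcfType.
Local Notation C := R[i].
Implicit Types (p : {poly C}) (q L : {poly {poly C}}).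

(** Boundedness and the Lipschitz property on each bidisc are bundled with a single constant because
    the product rule uses both; the class is then stable under sums and products. *)
Definition bounded_lipschitz (f : C -> C -> C) := forall B : R, exists2 K, 0 <= K &
  forall z w z' w', nm z <= B -> nm w <= B -> nm z' <= B -> nm w' <= B ->
  nm (f z w) <= K /\ nm (f z w - f z' w') <= K * (nm (z - z') + nm (w - w')).

Lemma bounded_lipschitz_ext f g : (forall z w, f z w = g z w) -> bounded_lipschitz f -> bounded_lipschitz g.
Proof.
move=> fg bf B; have [K K0 fK] := bf B; exists K => // z w z' w'.
by rewrite -!fg; exact: fK.
Qed.

Lemma bounded_lipschitz_cst c : bounded_lipschitz (fun _ _ => c).
Proof.
move=> B; exists (nm c); first exact: nm_ge0.
by move=> z w z' w' *; rewrite subrr nm0 mulr_ge0 ?addr_ge0 ?nm_ge0.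
Qed.

Lemma bounded_lipschitzD f g : bounded_lipschitz f -> bounded_lipschitz g -> bounded_lipschitz (fun z w => f z w + g z w).
Proof.
move=> bf bg B; have [K K0 fK] := bf B; have [K' K'0 gK] := bg B.
exists (K + K'); first exact: addr_ge0.
move=> z w z' w' z1 w1 z2 w2.
have [f1 f2] := fK _ _ _ _ z1 w1 z2 w2; have [g1 g2] := gK _ _ _ _ z1 w1 z2 w2.
split; first by rewrite (le_trans (nmD _ _)) // lerD.
by rewrite opprD addrACA (le_trans (nmD _ _)) // mulrDl lerD.
Qed.

Lemma bounded_lipschitzM f g : bounded_lipschitz f -> bounded_lipschitz g -> bounded_lipschitz (fun z w => f z w * g z w).
Proof.
move=> bf bg B; have [K K0 fK] := bf B; have [K' K'0 gK] := bg B.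
exists (K * K' + K' * K); first by rewrite addr_ge0 // mulr_ge0.
move=> z w z' w' z1 w1 z2 w2.
have [f1 f2] := fK _ _ _ _ z1 w1 z2 w2; have [g1 g2] := gK _ _ _ _ z1 w1 z2 w2.
have [g3 _] := gK _ _ _ _ z2 w2 z1 w1.
split.
  rewrite nmM (le_trans (ler_pM _ _ f1 g1)) ?nm_ge0 // lerDl mulr_ge0 //.
have -> : f z w * g z w - f z' w' * g z' w' =
  f z w * (g z w - g z' w') + g z' w' * (f z w - f z' w') by ring.
rewrite (le_trans (nmD _ _)) // !nmM mulrDl -!mulrA.
by rewrite lerD // ler_pM ?nm_ge0.
Qed.

Lemma bounded_lipschitz_poly q : bounded_lipschitz (fun z w => q.[w%:P].[z]).
Proof.
have bX1 : bounded_lipschitz (fun z w => z).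
  move=> B; exists (`|B| + 1); first by rewrite addr_ge0.
  move=> z w z' w' z1 *; split; first by rewrite (le_trans z1) //; have := ler_norm B; lra.
  by have := nm_ge0 (z - z'); have := nm_ge0 (w - w'); have := normr_ge0 B; nra.
have bX2 : bounded_lipschitz (fun z w => w).
  move=> B; exists (`|B| + 1); first by rewrite addr_ge0.
  move=> z w z' w' z1 w1 *; split; first by rewrite (le_trans w1) //; have := ler_norm B; lra.
  by have := nm_ge0 (z - z'); have := nm_ge0 (w - w'); have := normr_ge0 B; nra.
have b1 p : bounded_lipschitz (fun z w => p.[z]).
  elim/poly_ind: p => [|p c IH].
    by apply: bounded_lipschitz_ext (bounded_lipschitz_cst 0) => z w; rewrite horner0.
  apply: bounded_lipschitz_ext (bounded_lipschitzD (bounded_lipschitzM IH bX1) (bounded_lipschitz_cst c)) => z w.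
  by rewrite hornerMXaddC.
elim/poly_ind: q => [|q c IH].
  by apply: bounded_lipschitz_ext (bounded_lipschitz_cst 0) => z w; rewrite !horner0.
apply: bounded_lipschitz_ext (bounded_lipschitzD (bounded_lipschitzM IH bX2) (b1 c)) => z w.
by rewrite hornerMXaddC hornerD hornerM hornerC.
Qed.

(** Factor by factor, |z - r| <= |z0 - r| + |z - z0| <= |z0 - r| (1 + |z - z0| / d). This plays the
    part of a Harnack inequality for polynomials without roots near z0. *)
Lemma nm_horner_le p (z0 z : C) d n : 0 < d -> (size p <= n)%N ->
  (forall r, root p r -> d <= nm (z0 - r)) ->
  nm p.[z] <= nm p.[z0] * (1 + nm (z - z0) / d) ^+ n.
Proof.
move=> d0 pn pr; have [->|p0] := eqVneq p 0.
  by rewrite !horner0 nm0 mul0r.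
have [rs pE] := closed_field_poly_normal p.
have F1 : 1 <= 1 + nm (z - z0) / d by rewrite lerDl divr_ge0 ?nm_ge0 ?ltW.
have srs : (size rs <= n)%N.
  apply: leq_trans pn; rewrite pE size_scale ?lead_coef_eq0 //.
  by rewrite size_prod_XsubC.
apply: (@le_trans _ _ (nm p.[z0] * (1 + nm (z - z0) / d) ^+ size rs)); last first.
  by rewrite ler_wpM2l ?nm_ge0 // ler_weXn2l.
have {}pr r : r \in rs -> d <= nm (z0 - r).
  by move=> rrs; apply: pr; rewrite pE rootZ ?lead_coef_eq0 // root_prod_XsubC.
rewrite pE !hornerZ !nmM -mulrA ler_wpM2l ?nm_ge0 //.
rewrite !horner_prod !nm_prod {pE srs}.
elim: rs pr => [|r rs IH] pr; first by rewrite !big_nil expr0 mulr1.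
rewrite !big_cons exprS !hornerXsubC mulrACA ler_pM ?nm_ge0 ?prodr_ge0 //.
- by move=> *; rewrite nm_ge0.
- rewrite mulrDr mulr1 (le_trans (nm_triangle z0 _ _)) // addrC lerD2l.
  rewrite mulrCA -[leLHS]mulr1 ler_wpM2l ?nm_ge0 // lter_pdivlMr // mul1r.
  by rewrite pr ?mem_head.
- by apply: IH => r' r'rs; rewrite pr // in_cons r'rs orbT.
Qed.

(** Cauchy's root bound, uniform in z: for |w| > 1 the equation gives |w|^n <= S |w|^(n-1), with S a
    bound for the sum of the lower coefficients. *)
Lemma monic_root_bound q (B : R) : q \is monic -> (1 < size q)%N ->
  exists2 K, 0 <= K & forall z w, nm z <= B -> q.[w%:P].[z] = 0 -> nm w <= K.
Proof.
move=> mq sq.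
pose c i z := (q`_i).[z].
have [S S0 cS] : exists2 S, 0 <= S & forall z, nm z <= B ->
    \sum_(i < (size q).-1) nm (c i z) <= S.
  elim: (size q).-1 => [|n [S S0 cS]].
    by exists 0 => // z _; rewrite big_ord0.
  have [K K0 Kc] := bounded_lipschitz_poly (q`_n)%:P B.
  exists (S + K) => [|z zB]; first exact: addr_ge0.
  rewrite big_ord_recr /= lerD ?cS //.
  have zB' : nm (0 : C) <= B by rewrite nm0 (le_trans _ zB) ?nm_ge0.
  by have [] := Kc z 0 z 0 zB zB' zB zB'; rewrite hornerC.
exists (1 + S); first by rewrite addr_ge0.
move=> z w zB qzw.
have [w1|w1] := leP (nm w) 1; first by rewrite (le_trans w1) // lerDl.
have : nm w ^+ (size q).-1 <= S * nm w ^+ (size q).-2.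
  have : w ^+ (size q).-1 = - \sum_(i < (size q).-1) c i z * w ^+ i.
    apply/eqP; rewrite -addr_eq0; apply/eqP; rewrite -[RHS]qzw (horner_coef q) horner_sum.
    have := monic_neq0 mq; rewrite -size_poly_gt0.
    have := monicP mq; rewrite /lead_coef; case: (size q) => //= n qn _.
    rewrite big_ord_recr /= addrC qn mul1r -polyC_exp hornerC.
    by congr (_ + _); apply: eq_bigr => i _; rewrite hornerM -polyC_exp hornerC.
  move=> /(congr1 (@nm _)); rewrite nmX nmN => ->.
  apply: (le_trans (nm_sum _ _)); apply: le_trans (ler_wpM2r _ (cS _ zB)).
    rewrite mulr_suml ler_sum // => i _; rewrite nmM nmX ler_wpM2l ?nm_ge0 //.
    by rewrite ler_weXn2l ?ltW //; case: (_.-1) i => [[]//|m] i /=; rewrite -ltnS.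
  by rewrite exprn_ge0 ?nm_ge0.
have w0 : 0 < nm w by apply: lt_trans w1.
case: (size q) sq => [|[|n]] //= _.
by rewrite exprSr mulrC ler_pM2r ?exprn_gt0 // => /le_trans -> //; rewrite lerDr.
Qed.

End PolyEstimates.

(** * Local solvability of q = 0, L = m near an isolated common zero *)

Section LocalSolve.
Variable R : rcfType.
Local Notation C := R[i].
Implicit Types (q L : {poly {poly C}}).

Lemma exists_pos_le3 (a b c : R) : 0 < a -> 0 < b -> 0 < c ->
  exists2 d, 0 < d & [/\ d <= a, d <= b & d <= c].
Proof.
move=> a0 b0 c0; exists (Num.min a (Num.min b c)); first by rewrite !lt_min a0 b0.
by rewrite !ge_min !lexx !orbT.
Qed.

Lemma lower_bound_away (s : seq C) (f : C -> C) (w0 : C) :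
  (forall r, r \in s -> f r = 0 -> r = w0) ->
  exists2 l : R, 0 < l & forall r, r \in s -> r != w0 -> l <= nm (f r).
Proof.
elim: s => [|r s IH] fr; first by exists 1.
have [|l l0 ls] := IH; first by move=> r' r's; apply: fr; rewrite in_cons r's orbT.
have [rw|rw] := eqVneq r w0.
  exists l => // r'; rewrite in_cons => /predU1P[->|]; first by rewrite rw eqxx.
  exact: ls.
have fr0 : 0 < nm (f r).
  by rewrite nm_gt0; apply: contraNneq rw => /fr -> //; rewrite mem_head.
exists (Num.min l (nm (f r))); first by rewrite lt_min l0.
move=> r'; rewrite in_cons => /predU1P[-> _|r's rw'].
  by rewrite ge_min lexx orbT.
by rewrite ge_min ls.
Qed.

(** Continuity of roots: for z near z0 the product of the w - u over the roots u of q(z0, .) is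
    small, so w is near some u. At roots other than w0, |L| is at least a fixed l, which a small
    |L(z, w)| excludes. *)
Lemma root_localisation q L (z0 w0 : C) : q \is monic -> (1 < size q)%N ->
  (forall w, q.[w%:P].[z0] = 0 -> L.[w%:P].[z0] = 0 -> w = w0) ->
  forall r : R, 0 < r -> exists2 d, 0 < d <= r & exists2 m, 0 < m & forall z w,
  nm (z - z0) < d -> q.[w%:P].[z] = 0 -> nm (L.[w%:P].[z]) < m -> nm (w - w0) < r.
Proof.
move=> mq sq qL r r0.
have [W W0 qW] := monic_root_bound (nm z0 + 1) mq sq.
pose B := nm z0 + 1 + W.
have [K K0 Kq] := bounded_lipschitz_poly q B; have [K' K'0 KL] := bounded_lipschitz_poly L B.
have evE w : q.[w%:P].[z0] = (map_poly (horner_eval z0) q).[w].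
  by rewrite -[in RHS](hornerC w z0) -/(horner_eval z0 _) horner_map.
have [rs] := closed_field_poly_normal (map_poly (horner_eval z0) q).
rewrite (monicP (monic_map _ mq)) scale1r => qE.
have rsP w : w \in rs -> q.[w%:P].[z0] = 0.
  by move=> wrs; rewrite evE qE; apply/eqP; rewrite -[_ == 0]/(root _ w) root_prod_XsubC.
have [|l l0 ls] := @lower_bound_away rs (fun w => L.[w%:P].[z0]) w0.
  by move=> w /rsP; exact: qL.
have K1 : 0 < K + 1 by lra.
have K'1 : 0 < 4 * (K' + 1) by lra.
have [r1 r10 [r1r r1l _]] := exists_pos_le3 r0 (divr_gt0 l0 K'1) r0.
have [d d0 [d1 dr1 d2]] := exists_pos_le3 (@ltr01 R) r10 (divr_gt0 (exprn_gt0 (size rs) r10) K1).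
exists d; first by rewrite d0 (le_trans dr1).
exists (l / 4) => [|z w zd qzw Lm]; first by rewrite divr_gt0.
have zB : nm z <= nm z0 + 1.
  have := nm_triangle z0 z 0; rewrite !subr0; lra.
have wB : nm w <= B by have := qW _ _ zB qzw; rewrite /B; have := nm_ge0 z0; lra.
have z0B : nm z0 <= B by rewrite /B; lra.
have {}zB : nm z <= B by rewrite /B; lra.
have [|u urs wu] := @nm_lt_prod _ rs w r1 r10.
  have -> : \prod_(z <- rs) (w - z) = q.[w%:P].[z0].
    rewrite evE qE horner_prod; apply: eq_bigr => u _; by rewrite hornerXsubC.
  have [_] := Kq z0 w z w z0B wB zB wB.
  rewrite qzw subr0 subrr nm0 addr0 nm_dist => /le_lt_trans; apply.
  apply: (@le_lt_trans _ _ (K * d)); first by rewrite ler_wpM2l // ltW.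
  rewrite ler_pdivlMr // in d2; lra.
have uB : nm u <= B.
  have h : nm z0 <= nm z0 + 1 by lra.
  have := qW z0 u h (rsP _ urs); rewrite /B; have := nm_ge0 z0; lra.
have [<-|uw0] := eqVneq u w0; first exact: lt_le_trans wu r1r.
have := ls _ urs uw0.
have [_] := KL z0 u z w z0B uB zB wB.
have := nm_triangle (L.[w%:P].[z]) (L.[u%:P].[z0]) 0; rewrite !subr0.
rewrite (nm_dist z0) (nm_dist u) => h1 h2 h3.
have : K' * (nm (z - z0) + nm (w - u)) <= K' * (r1 + r1).
  by rewrite ler_wpM2l // lerD // ltW // (lt_le_trans zd).
have : (K' + 1) * r1 <= l / 4.
  by move: r1l; rewrite ler_pdivlMr // => h; lra.
lra.
Qed.

(* The eliminant N(z, m) of w from q = 0, L = m vanishes at (z0, 0) but not at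
   (zs, 0).  If for a small m all its roots were at distance >= d from z0, then
   [nm_horner_le] would bound |N(zs, m)| by a multiple of |N(z0, m)|. *)
Lemma local_solve q L (z0 w0 : C) : q \is monic ->
  q.[w0%:P].[z0] = 0 -> L.[w0%:P].[z0] = 0 ->
  (forall w, q.[w%:P].[z0] = 0 -> L.[w%:P].[z0] = 0 -> w = w0) ->
  (exists2 r : R, 0 < r & forall z w, nm (z - z0) < r -> nm (w - w0) < r ->
     q.[w%:P].[z] = 0 -> L.[w%:P].[z] = 0 -> z = z0) ->
  forall r : R, 0 < r -> exists2 m0, 0 < m0 & forall m, nm m < m0 ->
  exists z w, [/\ nm (z - z0) < r, nm (w - w0) < r,
                  q.[w%:P].[z] = 0 & L.[w%:P].[z] = m].
Proof.
move=> mq q0 L0 qL [r1 r10 iso] r r0.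
have sq : (1 < size q)%N.
  rewrite ltnNge; apply/negP => /size1_polyC qE; move: mq q0.
  rewrite monicE qE lead_coefC => /eqP ->; rewrite !hornerC => /eqP.
  by rewrite oner_eq0.
have [N NP] := monic_eliminant L mq sq.
have [r2 r20 [r2r r21 _]] := exists_pos_le3 r0 r10 r0.
have [d /andP[d0 dr2] [m1 m10 loc]] := root_localisation mq sq qL r20.
(* Any point at positive distance less than d from z0 would serve: there a common zero of q and L
   would be within r1 of (z0, w0), against isolation. *)
pose zs := z0 + (d / 2)%:C%C.
have zsz : nm (zs - z0) = d / 2.
  by rewrite /zs addrC addKr nm_real ger0_norm // divr_ge0 // ltW.
have Ns : N.[0%:P].[zs] != 0.
  apply/eqP => /NP[w [qw Lw]].
  have zsd : nm (zs - z0) < d by rewrite zsz; lra.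
  have wr : nm (w - w0) < r2 by apply: loc zsd qw _; rewrite Lw nm0.
  have := iso zs w _ _ qw Lw.
  rewrite (lt_le_trans (lt_le_trans zsd dr2) r21) (lt_le_trans wr r21).
  by move=> /(_ isT isT) /eqP; rewrite -subr_eq0 -nm_eq0 zsz gt_eqF ?divr_gt0.
have N0 : N.[0%:P].[z0] = 0 by apply/NP; exists w0.
have [K K0 KN] := bounded_lipschitz_poly N (nm z0 + nm zs + 1).
(* [sizeY N] bounds the degree in z of N(z, m) for every m, which makes the factor F independent of
   m. *)
pose F : R := (1 + nm (zs - z0) / d) ^+ sizeY N.
have F0 : 0 <= F by rewrite exprn_ge0 // addr_ge0 // divr_ge0 ?nm_ge0 ?ltW.
have KF : 0 < K * (F + 1) + 1 by rewrite ltr_wpDl // mulr_ge0 // addr_ge0.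
have Ns0 : 0 < nm N.[0%:P].[zs] by rewrite nm_gt0.
have [m0 m00 [m01 m0m1 m0N]] := exists_pos_le3 (@ltr01 R) m10 (divr_gt0 Ns0 KF).
exists m0 => // m mm0.
have Nm z : nm z <= nm z0 + nm zs ->
    nm (N.[m%:P].[z] - N.[0%:P].[z]) <= K * nm m.
  move=> zB; have [||||_] := KN z m z 0; rewrite ?nm0 ?subrr ?nm0 ?add0r ?subr0 //;
  have := nm_ge0 z; have := nm_ge0 z0; have := nm_ge0 zs; lra.
have [z [Nz zd]] : exists z, root N.[m%:P] z /\ nm (z0 - z) < d.
  apply: contrapT => nz.
  have /(_ N.[m%:P] z0 zs d (sizeY N) d0 (max_size_evalC _ _)) := @nm_horner_le R.
  rewrite -/F => hF.
  have {}hF : nm N.[m%:P].[zs] <= nm N.[m%:P].[z0] * F.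
    apply: hF => z Nz; rewrite leNgt; apply/negP => zd.
    by apply: nz; exists z.
  have h1 := Nm z0 _; have h2 := Nm zs _.
  have {}h1 : nm N.[m%:P].[z0] <= K * nm m.
    by have := h1 _; rewrite N0 subr0; apply; have := nm_ge0 zs; lra.
  have {}h2 : nm N.[0%:P].[zs] <= K * nm m + nm N.[m%:P].[zs].
    have zB : nm zs <= nm z0 + nm zs by rewrite lerDr nm_ge0.
    have := nm_triangle N.[m%:P].[zs] N.[0%:P].[zs] 0; rewrite !subr0.
    by move=> /le_trans; apply; rewrite lerD2r nm_dist h2.
  have h3 : K * nm m * F + K * nm m < nm N.[0%:P].[zs].
    rewrite ler_pdivlMr // in m0N.
    apply: lt_le_trans m0N; apply: (@le_lt_trans _ _ (nm m * (K * (F + 1) + 1))).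
      by have := nm_ge0 m; nra.
    by rewrite ltr_pM2r.
  have := ler_wpM2r F0 h1; lra.
move: Nz => /eqP /NP[w [qw Lw]].
have zd' : nm (z - z0) < d by rewrite nm_dist.
exists z, w; split => //.
  by rewrite (lt_le_trans zd') // (le_trans dr2).
have /lt_le_trans -> // : nm (w - w0) < r2.
by apply: loc zd' qw _; rewrite Lw (lt_le_trans mm0).
Qed.
End LocalSolve.

(** * Continuity and compactness in terms of the real modulus *)

Section ComplexTopology.
Variable R : realType.
Local Notation C := (R[i]^o).

Lemma near_nm (x : C) (d : R) : 0 < d -> \forall y \near x, nm (x - y) < d.
Proof.
move=> d0; have dC : 0 < d%:C%C :> R[i] by rewrite ltcR.
near=> y.
have : ball x d%:C%C y by near: y; exact: (@nbhsx_ballx _ C).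
by rewrite -ball_normE /= nm_normE ltcR.
Unshelve. all: by end_near. Qed.

(** The norm on [R[i]] is complex-valued, so the radius in [cvgrPdist_lt] is a complex number; its
    positivity forces it to be real. *)
Lemma nm_cvgP (T : Type) (F : set_system T) (FF : Filter F) (f : T -> C) (l : C) :
  (forall d : R, 0 < d -> \forall t \near F, nm (l - f t) < d) -> f @ F --> l.
Proof.
move=> h; apply/cvgrPdist_lt => e; rewrite ltcE => /andP[/eqP eI e0].
have := h _ e0; apply: filterS => t lt.
by rewrite nm_normE ltcE /= eI eqxx.
Qed.

Lemma nm_continuous : continuous (@nm R : C -> R).
Proof.
move=> x; have FF : Filter (nbhs x) by exact: nbhs_filter.
apply/cvgrPdist_lt => e e0; near=> y.
have xy : nm (x - y) < e by near: y; exact: (near_nm x e0).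
rewrite ltr_norml; have := nmB_ge x y; have := nmB_ge y x.
by rewrite (nm_dist y); lra.
Unshelve. all: by end_near. Qed.

Lemma bounded_lipschitz_continuous (f : R[i] -> R[i] -> R[i]) : bounded_lipschitz f ->
  continuous ((fun x => f x.1 x.2) : C * C -> C).
Proof.
move=> bf x; apply: nm_cvgP => d d0.
have [K K0 fK] := bf (nm x.1 + nm x.2 + 1).
have [a a0 ->] : exists2 a : R, 0 < a & d = (K + 1) * (a + a).
  exists (d / (2 * (K + 1))); last by field; lra.
  by rewrite divr_gt0 // mulr_gt0 //; lra.
near=> y.
have y1 : nm (x.1 - y.1) < a.
  by near: y; apply: (cvg_fst (near_nm x.1 a0)).
have y2 : nm (x.2 - y.2) < a.
  by near: y; apply: (cvg_snd (near_nm x.2 a0)).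
have y3 : nm (x.1 - y.1) < 1.
  by near: y; apply: (cvg_fst (near_nm x.1 ltr01)).
have y4 : nm (x.2 - y.2) < 1.
  by near: y; apply: (cvg_snd (near_nm x.2 ltr01)).
have [||||_ h] := fK x.1 x.2 y.1 y.2.
- by have := nm_ge0 x.2; lra.
- by have := nm_ge0 x.1; lra.
- have := nm_triangle x.1 y.1 0; rewrite !subr0 (nm_dist y.1).
  by have := nm_ge0 x.2; lra.
- have := nm_triangle x.2 y.2 0; rewrite !subr0 (nm_dist y.2).
  by have := nm_ge0 x.1; lra.
apply: (le_lt_trans h).
have : K * (nm (x.1 - y.1) + nm (x.2 - y.2)) <= K * (a + a).
  by rewrite ler_wpM2l // ltW // ltrD.
lra.
Unshelve. all: by end_near. Qed.

Lemma compact_disc (M : R) : compact [set x : C | nm x <= M].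
Proof.
pose g (p : R * R) : C := Complex p.1 p.2.
have gc : continuous g.
  move=> x; apply: nm_cvgP => d d0.
  have d2 : 0 < d / 2 by rewrite divr_gt0.
  near=> y.
  have y1 : `|x.1 - y.1| < d / 2.
    by near: y; apply: (cvg_fst (@nbhsx_ballx _ R x.1 (d / 2) d2)).
  have y2 : `|x.2 - y.2| < d / 2.
    by near: y; apply: (cvg_snd (@nbhsx_ballx _ R x.2 (d / 2) d2)).
  have -> : g x - g y = (x.1 - y.1)%:C%C + 'i%C * (x.2 - y.2)%:C%C.
    by apply/eqP; rewrite eq_complex /= !(mul0r, mul1r, mulr0, subr0, add0r, addr0) !eqxx.
  apply: (le_lt_trans (nmD _ _)); rewrite nmM !nm_real.
  by rewrite /= expr0n expr1n add0r sqrtr1 mul1r; lra.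
have cK : compact (g @` (`[- M, M] `*` `[- M, M])).
  apply: continuous_compact; first exact: continuous_subspaceT.
  by apply: compact_setX; exact: segment_compact.
apply: (subclosed_compact _ cK).
  apply: (@preimage_closed _ _ (@nm R : C -> R) [set x | x <= M]).
    by move=> x _; exact: nm_continuous.
  exact: closed_le.
move=> [a b] /= abM; exists (a, b) => //=.
have M0 : 0 <= M by rewrite (le_trans _ abM) // sqrtr_ge0.
split; rewrite in_itv /= -ler_norml (le_trans _ abM) // -sqrtr_sqr ler_wsqrtr //.
  by rewrite lerDl sqr_ge0.
by rewrite lerDr sqr_ge0.
Unshelve. all: by end_near. Qed.

End ComplexTopology.

Arguments Normc.normc : simpl never.

(** * The maximum principle on plane algebraic curves *)

Section CurveMaximum.
Variable R : realType.
Local Notation C := (R[i]^o).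
Implicit Types (q Q : {poly {poly R[i]}}).

Lemma nm_sqr_expand (x y : R[i]) :
  nm x ^+ 2 - nm y ^+ 2 = complex.Re (2 * conjc y * (x - y)) + nm (x - y) ^+ 2.
Proof.
rewrite !nm_sqr; case: x => a b; case: y => c d /=.
by rewrite !(mul0r, mulr0, add0r, addr0); ring.
Qed.

Definition curve q : set (C * C) :=
  [set x | nm x.1 <= 1 /\ nm x.2 <= 1 /\ q.[x.2%:P].[x.1] = 0].

Lemma nm_poly_continuous q :
  continuous (fun x : C * C => nm q.[x.2%:P].[x.1]).
Proof.
move=> x; apply: (continuous_comp (f := fun x : C * C => q.[x.2%:P].[x.1] : C)).
  exact: (bounded_lipschitz_continuous (bounded_lipschitz_poly q)).
exact: nm_continuous.
Qed.

Lemma nm_fst_continuous : continuous (fun x : C * C => nm x.1).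
Proof.
move=> x; apply: (continuous_comp (g := @nm R : C -> R)); first exact: cvg_fst.
exact: nm_continuous.
Qed.

Lemma nm_snd_continuous : continuous (fun x : C * C => nm x.2).
Proof.
move=> x; apply: (continuous_comp (g := @nm R : C -> R)); first exact: cvg_snd.
exact: nm_continuous.
Qed.

Lemma closed_curve q : closed (curve q).
Proof.
have -> : curve q = (fun x : C * C => nm x.1) @^-1` [set r | r <= 1] `&`
    ((fun x : C * C => nm x.2) @^-1` [set r | r <= 1] `&`
    (fun x : C * C => nm q.[x.2%:P].[x.1]) @^-1` [set r | r <= 0]).
  rewrite eqEsubset; split=> -[z w] /= [z1 [w1 qzw]]; do 2!split => //=.
    by rewrite qzw nm0.
  by apply/eqP; rewrite -nm_eq0 eq_le qzw nm_ge0.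
apply: closedI; last apply: closedI; apply: preimage_closed;
  try exact: closed_le; move=> x _.
- exact: nm_fst_continuous.
- exact: nm_snd_continuous.
- exact: nm_poly_continuous.
Qed.

Lemma compact_curve q : compact (curve q).
Proof.
apply: (@subclosed_compact _ _ ([set x : C | nm x <= 1] `*` [set x : C | nm x <= 1])).
- exact: closed_curve.
- by apply: compact_setX; exact: compact_disc.
- by move=> -[z w] [/= ? [? _]].
Qed.

Lemma gradient_polyE Q (a b c d e z0 w0 z w : R[i]) :
  (a%:P%:P * (Q - b%:P%:P) +
    e%:P%:P * (c%:P%:P * ('X%:P - z0%:P%:P) + d%:P%:P * ('X - w0%:P%:P))).[w%:P].[z] =
  a * (Q.[w%:P].[z] - b) + e * (c * (z - z0) + d * (w - w0)).
Proof. by rewrite !hornerE. Qed.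

Lemma add_cubeE q (c w0 z w : R[i]) :
  (q + c%:P%:P * ('X - w0%:P%:P) ^+ 3).[w%:P].[z] = q.[w%:P].[z] + c * (w - w0) ^+ 3.
Proof. by rewrite !hornerE. Qed.

(* Let x0 = (z0, w0) maximize |Q|^2 + e |x|^2 on the curve.  If x0 is interior, then
   L0 = 2 conj(Q x0) (Q - Q x0) + 2 e <x - x0, x0> satisfies
   Re L0 <= - e |x - x0|^2 on the curve.  The correction n (w - w0)^3 makes x0 the
   only common zero of q and L on the line z = z0, so that [local_solve] yields
   points of the curve near x0 where L is positive: a contradiction. *)
Lemma curve_max q Q : q \is monic -> q.[0%:P].[0] = 0 ->
  exists z w, [/\ nm z <= 1, nm w <= 1, nm z = 1 \/ nm w = 1,
    q.[w%:P].[z] = 0 & nm Q.[0%:P].[0] <= nm Q.[w%:P].[z]].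
Proof.
move=> mq q00; apply: contrapT => nex.
have bd z w : nm z <= 1 -> nm w <= 1 -> nm z = 1 \/ nm w = 1 ->
    q.[w%:P].[z] = 0 -> nm Q.[w%:P].[z] < nm Q.[0%:P].[0].
  move=> z1 w1 zw qzw; rewrite ltNge; apply/negP => h.
  by apply: nex; exists z, w.
(* Compactness of the part of the curve on the boundary of the bidisc turns the strict inequality
   [bd] into a uniform gap. *)
have [eta eta0 bdeta] : exists2 eta, 0 < eta & forall z w, nm z <= 1 -> nm w <= 1 ->
    nm z = 1 \/ nm w = 1 -> q.[w%:P].[z] = 0 ->
    nm Q.[w%:P].[z] ^+ 2 + eta <= nm Q.[0%:P].[0] ^+ 2.
  pose Zb := curve q `&` [set x : C * C | nm x.1 = 1 \/ nm x.2 = 1].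
  have [Zb0|/set0P Zb0] := eqVneq Zb set0.
    exists 1 => // z w z1 w1 zw qzw; exfalso.
    by have : Zb (z, w) by []; rewrite Zb0.
  have cZb : compact Zb.
    apply: (subclosed_compact _ (compact_curve (q := q))); last by move=> ? [].
    apply: closedI; first exact: closed_curve.
    have -> : [set x : C * C | nm x.1 = 1 \/ nm x.2 = 1] =
      (fun x : C * C => nm x.1) @^-1` [set r | r = 1] `|`
      (fun x : C * C => nm x.2) @^-1` [set r | r = 1] by [].
    apply: closedU; apply: preimage_closed; rewrite ?closed_eq //;
      try exact: closed_eq; move=> x _.
    + exact: nm_fst_continuous.
    + exact: nm_snd_continuous.
  have [|[z w] /set_mem[[/= z1 [w1 qzw]] zw] Qmax] := compact_EVT_max Zb0 cZb (f := fun x : C * C => nm Q.[x.2%:P].[x.1]).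
    by apply: continuous_subspaceT => x; exact: nm_poly_continuous.
  have lt_zw := bd _ _ z1 w1 zw qzw.
  exists (nm Q.[0%:P].[0] ^+ 2 - nm Q.[w%:P].[z] ^+ 2).
    by rewrite subr_gt0 ltr_pXn2r ?nnegrE ?nm_ge0.
  move=> z' w' z'1 w'1 z'w' qz'w'.
  have : nm Q.[w'%:P].[z'] <= nm Q.[w%:P].[z] by apply: (Qmax (z', w')); apply: mem_set.
  by move=> h; have := nm_ge0 Q.[w'%:P].[z']; nra.
(* On the bidisc |x|^2 <= 2, so e |x|^2 <= eta / 2 does not fill the gap eta, and the maximum of
   [rho] stays off the boundary. *)
pose e := eta / 4.
have e0 : 0 < e by rewrite divr_gt0.
pose rho (x : C * C) := nm Q.[x.2%:P].[x.1] ^+ 2 + e * (nm x.1 ^+ 2 + nm x.2 ^+ 2).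
have rho00 : rho (0, 0) = nm Q.[0%:P].[0] ^+ 2.
  by rewrite /rho /= !nm0 !expr0n /= addr0 mulr0 addr0.
have [||[z0 w0] /set_mem[/= z01 [w01 qz0]] rmax] := compact_EVT_max _ (compact_curve (q := q)) (f := rho).
- by exists (0, 0); split; rewrite /= ?nm0.
- apply: continuous_subspaceT => x; rewrite /rho.
  have c1 : {for x, continuous (fun x : C * C => nm x.1)}.
    exact: nm_fst_continuous.
  have c2 : {for x, continuous (fun x : C * C => nm x.2)}.
    exact: nm_snd_continuous.
  apply: cvgD; first by apply: cvgM; exact: nm_poly_continuous.
  by apply: cvgM; [exact: cvg_cst|apply: cvgD; apply: cvgM].
have {}rmax z w : nm z <= 1 -> nm w <= 1 -> q.[w%:P].[z] = 0 -> rho (z, w) <= rho (z0, w0).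
  by move=> *; apply: (rmax (z, w)); apply: mem_set.
have [z0lt w0lt] : nm z0 < 1 /\ nm w0 < 1.
  have nbd : ~ (nm z0 = 1 \/ nm w0 = 1).
    move=> /bdeta-/(_ z01 w01 qz0) h.
    have := rmax 0 0; rewrite nm0 => /(_ ler01 ler01 q00); rewrite rho00 /rho /= /e.
    have hz : nm z0 ^+ 2 <= 1 by rewrite exprn_ile1 ?nm_ge0.
    have hw : nm w0 ^+ 2 <= 1 by rewrite exprn_ile1 ?nm_ge0.
    have : eta / 4 * (nm z0 ^+ 2 + nm w0 ^+ 2) <= eta / 4 * 2.
      by rewrite ler_pM2l ?divr_gt0 //; lra.
    lra.
  by rewrite !lt_neqAle z01 w01 !andbT; split; apply/eqP => h; apply: nbd; [left|right].
pose Q0 := Q.[w0%:P].[z0].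
pose L0 : {poly {poly R[i]}} :=
  (2 * conjc Q0)%:P%:P * (Q - Q0%:P%:P) +
  e%:C%C%:P%:P * ((2 * conjc z0)%:P%:P * ('X%:P - z0%:P%:P) +
                  (2 * conjc w0)%:P%:P * ('X - w0%:P%:P)).
have L0E z w : L0.[w%:P].[z] = 2 * conjc Q0 * (Q.[w%:P].[z] - Q0) +
    e%:C%C * (2 * conjc z0 * (z - z0) + 2 * conjc w0 * (w - w0)).
  exact: gradient_polyE.
have ReL0 z w : nm z <= 1 -> nm w <= 1 -> q.[w%:P].[z] = 0 ->
    complex.Re L0.[w%:P].[z] <= - e * (nm (z - z0) ^+ 2 + nm (w - w0) ^+ 2).
  move=> z1 w1 qzw; have := rmax z w z1 w1 qzw; rewrite /rho /= -/Q0 L0E.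
  have := nm_sqr_expand Q.[w%:P].[z] Q0.
  have := nm_sqr_expand z z0; have := nm_sqr_expand w w0.
  have ReD (a b : R[i]) : complex.Re (a + b) = complex.Re a + complex.Re b by case: a; case: b.
  have ReZ (a : R) (b : R[i]) : complex.Re (a%:C%C * b) = a * complex.Re b.
    by case: b => b1 b2 /=; rewrite mul0r subr0.
  rewrite !(ReD, ReZ); have := sqr_ge0 (nm (Q.[w%:P].[z] - Q0)); nra.
have [rs qrs] : exists rs : seq R[i], forall w, q.[w%:P].[z0] = 0 -> w \in rs.
  have [rs] := closed_field_poly_normal (map_poly (horner_eval z0) q).
  rewrite (monicP (monic_map _ mq)) scale1r => qE; exists rs => w.
  rewrite -root_prod_XsubC -qE /root => qw; apply/eqP; rewrite -[RHS]qw.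
  by rewrite -[in LHS](hornerC w z0) -/(horner_eval z0 _) horner_map.
(* Taking n above F at every root r of q(z0, .) prevents L0 + n (r - w0)^3 from vanishing unless r =
   w0. At r = w0 the division by zero makes F equal to 0, which is harmless. *)
pose F r := nm (L0.[r%:P].[z0] / (r - w0) ^+ 3).
have [n nF] : exists n : nat, forall r, r \in rs -> F r < n%:R.
  elim: rs {qrs} => [|r rs [n nF]]; first by exists 0%N.
  have [m mF] : exists m : nat, F r < m%:R.
    by exists (Num.bound (F r)); apply: archi_boundP; exact: nm_ge0.
  exists (n + m)%N => r'; rewrite in_cons natrD => /predU1P[->|/nF rn].
    by rewrite ltr_wpDl.
  by rewrite ltr_wpDr.
pose L := L0 + n%:R%:P%:P * ('X - w0%:P%:P) ^+ 3.
have LE z w : L.[w%:P].[z] = L0.[w%:P].[z] + n%:R * (w - w0) ^+ 3 by exact: add_cubeE.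
have nC : nm (n%:R : R[i]) = n%:R by rewrite -[n%:R](rmorph_nat (real_complex R)) nm_real normr_nat.
have Lw0 : L.[w0%:P].[z0] = 0 by rewrite LE L0E !subrr !(mulr0, addr0, expr0n).
have isoL w : q.[w%:P].[z0] = 0 -> L.[w%:P].[z0] = 0 -> w = w0.
  move=> /qrs/nF; rewrite LE => Fw /eqP; rewrite addr_eq0 => /eqP Lw.
  apply/eqP; apply: contraLR Fw => ww0; rewrite /F Lw mulNr mulfK ?nmN ?nC ?ltxx //.
  by rewrite expf_eq0 /= subr_eq0.
have r10 : 0 < 1 - nm z0 by lra.
have r20 : 0 < 1 - nm w0 by lra.
have n1 : 0 < n%:R + 1 :> R by rewrite ltr_wpDl.
(* Within this radius n |w - w0|^3 <= (e / 2) |w - w0|^2, so the cubic correction uses up at most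
   half of the quadratic gain in [ReL0]. *)
have r30 : 0 < e / (2 * (n%:R + 1)) by rewrite divr_gt0 // mulr_gt0.
have [r r0 [rz rw re]] := exists_pos_le3 r10 r20 r30.
have ReL z w : nm (z - z0) < r -> nm (w - w0) < r -> q.[w%:P].[z] = 0 ->
    complex.Re L.[w%:P].[z] <= - (e / 2) * (nm (z - z0) ^+ 2 + nm (w - w0) ^+ 2).
  move=> zr wr qzw.
  have z1 : nm z <= 1 by have := nm_triangle z0 z 0; rewrite !subr0; lra.
  have w1 : nm w <= 1 by have := nm_triangle w0 w 0; rewrite !subr0; lra.
  have := ReL0 _ _ z1 w1 qzw; rewrite LE.
  have -> (a b : R[i]) : complex.Re (a + b) = complex.Re a + complex.Re b by case: a; case: b.
  have := Re_le_nm (n%:R * (w - w0) ^+ 3); rewrite nmM nmX nC.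
  have : n%:R * nm (w - w0) <= e / 2.
    rewrite ler_pdivlMr ?mulr_gt0 // in re.
    have : nm (w - w0) * (2 * (n%:R + 1)) <= r * (2 * (n%:R + 1)).
      by rewrite ler_wpM2r ?ltW // mulr_gt0.
    by have := nm_ge0 (w - w0); lra.
  move: (nm_ge0 (w - w0)) (nm_ge0 (z - z0)); move: (nm (w - w0)) (nm (z - z0)) => a b a0 b0 na.
  have : n%:R * a ^+ 3 <= e / 2 * a ^+ 2.
    by rewrite exprS mulrA ler_wpM2r // sqr_ge0.
  by have := sqr_ge0 b; nra.
(* [ReL] is used twice: it shows that the common zero is isolated, and it forbids the positive value
   m0 / 2 that L takes by local solvability. *)
have [|m0 m00 /(_ (m0 / 2)%:C%C)] := local_solve mq qz0 Lw0 isoL _ r0.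
- exists r => // z w zr wr qzw Lzw; have := ReL z w zr wr qzw; rewrite Lzw /=.
  move=> h; apply/eqP; rewrite -subr_eq0 -nm_eq0 -sqrf_eq0 eq_le sqr_ge0 andbT.
  by have := sqr_ge0 (nm (w - w0)); nra.
rewrite nm_real ger0_norm ?divr_ge0 ?ltW // => -[].
  by rewrite ltr_pdivrMr //; lra.
move=> z [w [zr wr qzw Lzw]]; have := ReL z w zr wr qzw; rewrite Lzw /=.
have := sqr_ge0 (nm (w - w0)); have := sqr_ge0 (nm (z - z0)); nra.
Qed.

End CurveMaximum.

(** * Choice of the thresholds e_j and the hull of K *)

Section BaseHull.
Variable R : realType.
Local Notation C := (R[i]^o).
Implicit Types (q P Q : {poly {poly R[i]}}).

Lemma exists_expr_lt (x y : R) : 0 <= x < 1 -> 0 < y -> exists k, x ^+ k < y.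
Proof.
move=> /andP[x0 x1] y0.
have [->|xn0] := eqVneq x 0; first by exists 1%N; rewrite expr0n.
have xp : 0 < x by rewrite lt_neqAle eq_sym xn0.
have xv : 0 < x^-1 - 1 by rewrite subr_gt0 invf_gt1.
pose k := Num.bound (y^-1 / (x^-1 - 1)).
have kP : y^-1 / (x^-1 - 1) < k%:R by apply: archi_boundP; rewrite divr_ge0 ?invr_ge0 ?ltW.
exists k; rewrite -[ltRHS]invrK -[ltLHS]invrK ltf_pV2 ?posrE ?invr_gt0 ?exprn_gt0 //.
rewrite -exprVn; rewrite ltr_pdivrMr // in kP; apply: (lt_le_trans kP).
rewrite -[x^-1](subrK 1) addrK; move: (x^-1 - 1) xv => u u0 {kP xp xn0 x0 x1}.
elim: k => [|k IH]; first by rewrite mul0r expr0.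
rewrite exprS -natr1 mulrDl mul1r.
have h : 1 <= (u + 1) ^+ k by rewrite exprn_ege1 //; lra.
nra.
Qed.

Lemma poly_bidisc_bound P : exists2 M : R, 0 < M &
  forall z w, nm z <= 1 -> nm w <= 1 -> nm P.[w%:P].[z] <= M.
Proof.
have [K K0 PK] := bounded_lipschitz_poly P 1; exists (K + 1); first by lra.
by move=> z w z1 w1; have [h _] := PK z w z w z1 w1 z1 w1; lra.
Qed.

(** The state of the recursion: a polynomial bounded by 1 on the bidisc, and a level below its
    modulus at 0, under which it is kept wherever some earlier |p_i| is smaller than e_i. *)
Definition peaked_state (s : {poly {poly R[i]}} * R) :=
  0 <= s.2 < nm s.1.[0%:P].[0] /\
  forall z w, nm z <= 1 -> nm w <= 1 -> nm s.1.[w%:P].[z] <= 1.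

(* The new function is Q^k P / M with M a bound of |P| and k large. *)
Lemma peaked_step P (s : {poly {poly R[i]}} * R) :
  P.[0%:P].[0] != 0 -> peaked_state s ->
  exists (t : ({poly {poly R[i]}} * R) * R), [/\ peaked_state t.1, 0 < t.2,
    (forall z w, nm z <= 1 -> nm w <= 1 -> nm s.1.[w%:P].[z] <= s.2 ->
      nm t.1.1.[w%:P].[z] <= t.1.2) &
    (forall z w, nm z <= 1 -> nm w <= 1 -> nm P.[w%:P].[z] < t.2 ->
      nm t.1.1.[w%:P].[z] <= t.1.2)].
Proof.
case: s => Q r P0 [/= /andP[r0 rQ] Q1].
have [M M0 PM] := poly_bidisc_bound P.
set th := nm Q.[0%:P].[0] in rQ.
have th0 : 0 < th by apply: le_lt_trans rQ.
have a0 : 0 < nm P.[0%:P].[0] / M by rewrite divr_gt0 // nm_gt0.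
(* This k gives r^k < th^k |P(0)| / M = |Q'(0)|: the earlier bound, raised to the power k, stays
   below the new value at 0. *)
have [|k kP] := @exists_expr_lt (r / th) _ _ a0.
  by rewrite divr_ge0 ?(ltW th0) //= ltr_pdivrMr // mul1r.
pose Q' := (M^-1)%:C%C%:P%:P * Q ^+ k * P.
have Q'E z w : nm Q'.[w%:P].[z] = nm Q.[w%:P].[z] ^+ k * (nm P.[w%:P].[z] / M).
  rewrite /Q' !(hornerM, horner_exp, hornerC) nmM nmM nmX nm_real ger0_norm ?invr_ge0 ?ltW //.
  by rewrite -mulrA mulrC -mulrA.
pose th' := nm Q'.[0%:P].[0].
have th'0 : 0 < th' by rewrite /th' Q'E mulr_gt0 // exprn_gt0.
have rth' : r ^+ k < th'.
  rewrite /th' Q'E -/th mulrC -ltr_pdivrMr ?exprn_gt0 //.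
  by rewrite -expr_div_n.
have PM1 z w : nm z <= 1 -> nm w <= 1 -> 0 <= nm P.[w%:P].[z] / M <= 1.
  move=> z1 w1; rewrite divr_ge0 ?nm_ge0 ?(ltW M0) //=.
  by rewrite ler_pdivrMr // mul1r PM.
(* Where |P| < M th' / 2 one has |Q'| <= th' / 2, half the value at 0; the new level covers both
   this region and the earlier ones. *)
exists ((Q', Num.max (r ^+ k) (th' / 2)), M * (th' / 2)); split => /=.
- split=> /=.
    rewrite le_max exprn_ge0 //= gt_max rth' -/th'; lra.
  move=> z w z1 w1; have /andP[u0 u1] := PM1 _ _ z1 w1.
  by rewrite Q'E mulr_ile1 ?exprn_ge0 ?nm_ge0 // exprn_ile1 ?nm_ge0 ?Q1.
- by rewrite mulr_gt0 // divr_gt0.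
- move=> z w z1 w1 Qr; have /andP[u0 u1] := PM1 _ _ z1 w1.
  rewrite Q'E le_max; apply/orP; left; rewrite -[leRHS]mulr1 ler_pM ?exprn_ge0 ?nm_ge0 //.
  by rewrite lerXn2r ?nnegrE ?nm_ge0.
move=> z w z1 w1 Pt; have /andP[u0 u1] := PM1 _ _ z1 w1.
rewrite Q'E le_max; apply/orP; right; rewrite -[leRHS]mul1r ler_pM ?exprn_ge0 ?nm_ge0 //.
  by rewrite exprn_ile1 ?nm_ge0 ?Q1.
by rewrite ler_pdivrMr // mulrC ltW.
Qed.

(** The threshold e_j is produced at step j and never revised. The polynomial of stage n serves all
    i < n because each step preserves the control gained before it. *)
Lemma peaked_thresholds (p : nat -> {poly {poly R[i]}}) :
  (forall j, (p j).[0%:P].[0] != 0) ->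
  exists2 e : nat -> R, (forall j, 0 < e j) & forall n, exists Q,
    forall z w i, nm z <= 1 -> nm w <= 1 -> (i < n)%N ->
    nm (p i).[w%:P].[z] < e i -> nm Q.[w%:P].[z] < nm Q.[0%:P].[0].
Proof.
move=> p0.
have st0 : peaked_state (1, 0).
  by split=> [|z w _ _] /=; rewrite !hornerC nm1 ?lexx ?ltr01.
have /choice[f fP] : forall x : nat * ({poly {poly R[i]}} * R),
    exists t : ({poly {poly R[i]}} * R) * R, peaked_state x.2 ->
    [/\ peaked_state t.1, 0 < t.2,
    (forall z w, nm z <= 1 -> nm w <= 1 -> nm x.2.1.[w%:P].[z] <= x.2.2 ->
      nm t.1.1.[w%:P].[z] <= t.1.2) &
    (forall z w, nm z <= 1 -> nm w <= 1 -> nm (p x.1).[w%:P].[z] < t.2 ->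
      nm t.1.1.[w%:P].[z] <= t.1.2)].
  move=> [j s]; have [gs|ngs] := pselect (peaked_state s); last by exists (s, 0) => /ngs.
  by have [t tP] := peaked_step (p0 j) gs; exists t.
pose fix st n : {poly {poly R[i]}} * R :=
  if n is n'.+1 then (f (n', st n')).1 else (1, 0).
have stP n : peaked_state (st n) by elim: n => // n IH; case: (fP (n, st n) IH).
exists (fun n => (f (n, st n)).2) => [j|n].
  by have [] := fP (j, st j) (stP j).
exists (st n).1 => z w i z1 w1 ltin pe.
have [/andP[_ ltst] _] := stP n.
apply: le_lt_trans ltst.
elim: n ltin => // n IH; rewrite ltnS leq_eqVlt => /predU1P[ein|/IH].
  by rewrite -ein /=; have [_ _ _] := fP (i, st i) (stP i); apply.
by have [_ _ h _] := fP (n, st n) (stP n); apply: h.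
Qed.

(* The term t w^N turns P - l D into a monic polynomial in w. *)
Lemma base_hull (p : nat -> {poly {poly R[i]}}) (e : nat -> R) :
  (forall n, exists Q,
    forall z w i, nm z <= 1 -> nm w <= 1 -> (i < n)%N ->
    nm (p i).[w%:P].[z] < e i -> nm Q.[w%:P].[z] < nm Q.[0%:P].[0]) ->
  forall (P D : {poly {poly R[i]}}) (M r : R), 0 < r -> D.[0%:P].[0] != 0 ->
  (forall z w, nm z <= 1 -> nm w <= 1 -> nm z = 1 \/ nm w = 1 ->
     (forall i, e i <= nm (p i).[w%:P].[z]) ->
     nm P.[w%:P].[z] <= M * nm D.[w%:P].[z] /\ r <= nm D.[w%:P].[z]) ->
  nm P.[0%:P].[0] <= M * nm D.[0%:P].[0].
Proof.
move=> eP P D M r r0 D0 PD; rewrite leNgt; apply/negP => MP.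
pose l := P.[0%:P].[0] / D.[0%:P].[0].
have D0' : 0 < nm D.[0%:P].[0] by rewrite nm_gt0.
have lM : M < nm l by rewrite /l nmM nmV ltr_pdivlMr.
(* On the curve q = 0 in the bidisc, |P - l D| = t |w|^N <= t. At a point with |P| <= M |D| and |D|
   >= r, however, |P - l D| >= (|l| - M) r = 2 t. *)
pose t := (nm l - M) * r / 2.
have t0 : 0 < t by rewrite divr_gt0 // mulr_gt0 // subr_gt0.
pose N := (size P + size D).+1.
pose q := (t^-1)%:C%C%:P%:P * (P - l%:P%:P * D) + 'X^N.
have qE z w : q.[w%:P].[z] = (t^-1)%:C%C * (P.[w%:P].[z] - l * D.[w%:P].[z]) + w ^+ N.
  by rewrite /q !hornerE.
have mq : q \is monic.
  rewrite monicE /q addrC lead_coefDl ?lead_coefXn // size_polyXn ltnS /N.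
  rewrite mul_polyC (leq_trans (size_scale_leq _ _)) //.
  rewrite (leq_trans (size_polyD _ _)) // size_polyN mul_polyC geq_max.
  rewrite (leq_trans (leq_addr (size D) _)) //=.
  by rewrite (leq_trans (size_scale_leq _ _)) // (leq_trans (leq_addl (size P) _)).
have q0 : q.[0%:P].[0] = 0.
  by rewrite qE /l divfK // subrr mulr0 add0r expr0n.
(* The point x_n satisfies only the first n conditions; a cluster point on the compact curve
   satisfies them all, since each is closed and holds eventually. *)
have /choice[x xP] : forall n, exists x : C * C,
    curve q x /\ ((nm x.1 = 1 \/ nm x.2 = 1) /\
    forall i, (i < n)%N -> e i <= nm (p i).[x.2%:P].[x.1]).
  move=> n; have [Q QP] := eP n.
  have [z [w [z1 w1 zw qzw Qzw]]] := curve_max Q mq q0.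
  exists (z, w); split=> //; split => //= i ltin; rewrite leNgt; apply/negP => h.
  by have := QP z w i z1 w1 ltin h; rewrite ltNge Qzw.
have [[z w] [[/= z1 [w1 qzw]] clx]] : curve q `&` cluster (x @ \oo) !=set0.
  by apply: compact_curve; exists 0%N => // n _; have [] := xP n.
have clE (E : set (C * C)) : closed E -> (\forall n \near \oo, E (x n)) -> E (z, w).
  move=> cE xE; apply: cE => U Uzw.
  by have := clx _ _ xE Uzw.
have zw : nm z = 1 \/ nm w = 1.
  pose E := (fun x : C * C => nm x.1) @^-1` [set r | r = 1] `|`
            (fun x : C * C => nm x.2) @^-1` [set r | r = 1].
  apply: (clE E); last by exists 0%N => // n _; have [_ []] := xP n.
  apply: closedU; apply: preimage_closed; try exact: closed_eq; move=> y _.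
    exact: nm_fst_continuous.
  exact: nm_snd_continuous.
have pe i : e i <= nm (p i).[w%:P].[z].
  apply: (clE ((fun x : C * C => nm (p i).[x.2%:P].[x.1]) @^-1` [set r | e i <= r])).
    apply: preimage_closed; last exact: closed_ge.
    by move=> y _; exact: nm_poly_continuous.
  by exists i.+1 => // n /= ltin; have [_ [_]] := xP n; apply.
have [PM rD] := PD z w z1 w1 zw pe.
have : nm (P.[w%:P].[z] - l * D.[w%:P].[z]) <= t.
  have -> : P.[w%:P].[z] - l * D.[w%:P].[z] = - t%:C%C * w ^+ N.
    have tC : t%:C%C != 0 :> R[i] by rewrite -nm_eq0 nm_real normr_eq0 gt_eqF.
    apply: (mulfI (_ : (t^-1)%:C%C != 0)); first by rewrite -nm_eq0 nm_real normr_eq0 gt_eqF // invr_gt0.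
    have tV : (t^-1)%:C%C * t%:C%C = 1 :> R[i].
      by rewrite -(rmorphM (real_complex R)) mulVf ?gt_eqF.
    apply/eqP; rewrite mulNr mulrN -subr_eq0 opprK mulrA tV mul1r.
    by rewrite -qE qzw.
  rewrite nmM nmN nm_real nmX (ger0_norm (ltW t0)).
  by rewrite ler_piMr ?exprn_ile1 ?nm_ge0 // (ltW t0).
have := nmB_ge (l * D.[w%:P].[z]) P.[w%:P].[z].
rewrite nm_dist nmM /t => h1 h2.
have : (nm l - M) * r <= (nm l - M) * nm D.[w%:P].[z] by rewrite ler_wpM2l // subr_ge0 ltW.
have : 0 < (nm l - M) * r by rewrite mulr_gt0 // subr_gt0.
lra.
Qed.

End BaseHull.

(** * A countable dense family of polynomials that do not vanish at 0 *)

Section GaussianRationals.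
Variable R : realType.

(* Locked because unification of a Gaussian rational with 1 would otherwise
   unfold [ratr]. *)
Fact gauss_key : unit. Proof. exact: tt. Qed.
Definition gauss : rat * rat -> R[i] :=
  locked_with gauss_key (fun c => Complex (ratr c.1) (ratr c.2)).

Lemma gaussE c : gauss c = Complex (ratr c.1) (ratr c.2).
Proof. by rewrite /gauss unlock. Qed.

Lemma gauss_dense (x : R[i]) (e : R) : 0 < e -> exists c, nm (x - gauss c) <= e.
Proof.
move=> e0; have ratd (a : R) : exists r : rat, `|a - ratr r| <= e / 2.
  have [|r] := @rat_in_itvoo R (a - e / 2) (a + e / 2); first by lra.
  by rewrite in_itv /= => /andP[r1 r2]; exists r; rewrite ler_norml; lra.
case: x => a b; have [r ar] := ratd a; have [s bs] := ratd b.
exists (r, s).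
have -> : Complex a b - gauss (r, s) = (a - ratr r)%:C%C + 'i%C * (b - ratr s)%:C%C.
  rewrite gaussE; apply/eqP.
  by rewrite eq_complex /= !(mul0r, mul1r, mulr0, subr0, add0r, addr0) !eqxx.
apply: (le_trans (nmD _ _)); rewrite nmM !nm_real.
have -> : nm ('i%C : R[i]) = 1 by rewrite /Normc.normc expr0n expr1n add0r sqrtr1.
by rewrite mul1r; lra.
Qed.

Definition gauss_poly (s : seq (seq (rat * rat))) : {poly {poly R[i]}} :=
  Poly (map (fun l => Poly (map gauss l)) s).

Lemma gauss_poly_dense (P : {poly {poly R[i]}}) (e : R) : 0 < e ->
  exists s, forall z w, nm z <= 1 -> nm w <= 1 ->
    nm (P.[w%:P].[z] - (gauss_poly s).[w%:P].[z]) <= e.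
Proof.
have dense1 (p : {poly R[i]}) : forall e : R, 0 < e -> exists l, forall z, nm z <= 1 ->
    nm (p.[z] - (Poly (map gauss l)).[z]) <= e.
  elim/poly_ind: p => [|p c IH] d d0.
    by exists [::] => z _; rewrite /= subrr nm0 ltW.
  have d2 : 0 < d / 2 by rewrite divr_gt0.
  have [l lP] := IH _ d2; have [x cx] := gauss_dense c d2.
  exists (x :: l) => z z1; rewrite /= cons_poly_def !hornerMXaddC opprD addrACA.
  rewrite (le_trans (nmD _ _)) // -mulrBl nmM.
  have := lP z z1; have := nm_ge0 (p.[z] - (Poly (map gauss l)).[z]).
  by have := nm_ge0 z; nra.
elim/poly_ind: P e => [|P c IH] d d0.
  by exists [::] => z w _ _; rewrite /= !hornerC subrr nm0 ltW.
have d2 : 0 < d / 2 by rewrite divr_gt0.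
have [s sP] := IH _ d2; have [x cx] := dense1 c _ d2.
exists (x :: s) => z w z1 w1; rewrite /gauss_poly /= cons_poly_def !hornerMXaddC.
rewrite !hornerD !hornerM !hornerC opprD addrACA (le_trans (nmD _ _)) // -mulrBl nmM.
have := sP z w z1 w1; have := cx z z1; rewrite /gauss_poly.
by set a := nm _; set b := nm _; have := nm_ge0 w; have : 0 <= b := nm_ge0 _; nra.
Qed.

Definition base_poly (j : nat) : {poly {poly R[i]}} :=
  if unpickle j is Some s then
    if (gauss_poly s).[0%:P].[0] == 0 then 1 else gauss_poly s
  else 1.

Lemma base_poly_neq0 j : (base_poly j).[0%:P].[0] != 0.
Proof.
rewrite /base_poly; case: unpickle => [s|]; last by rewrite !hornerE oner_neq0.
by case: ifPn => [_|//]; rewrite !hornerC oner_neq0.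
Qed.

Lemma base_poly_dense (P : {poly {poly R[i]}}) (e : R) : 0 < e ->
  exists j, forall z w, nm z <= 1 -> nm w <= 1 ->
    nm (P.[w%:P].[z] - (base_poly j).[w%:P].[z]) <= e.
Proof.
move=> e0.
(* A shift by e / 2 moves the value at 0 away from 0, so that a Gaussian approximation within e / 8
   is not replaced by 1 in [base_poly]. *)
have [P1 P1P P10] : exists2 P1 : {poly {poly R[i]}},
    forall z w, nm (P.[w%:P].[z] - P1.[w%:P].[z]) <= e / 2 &
    e / 4 <= nm P1.[0%:P].[0].
  have [h|h] := leP (e / 4) (nm P.[0%:P].[0]).
    by exists P => // z w; rewrite subrr nm0 divr_ge0 // ltW.
  exists (P + (e / 2)%:C%C%:P%:P) => [z w|].
    rewrite !hornerD !hornerC opprD addNKr nmN nm_real ger0_norm //.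
    by rewrite divr_ge0 // ltW.
  rewrite !hornerD !hornerC addrC -[P.[_].[_]]opprK.
  have := nmB_ge (e / 2)%:C%C (- P.[0%:P].[0]); rewrite nmN nm_real.
  have e2 : 0 <= e / 2 by rewrite divr_ge0 // ltW.
  by rewrite (ger0_norm e2); lra.
have [|s sP] := @gauss_poly_dense P1 (e / 8); first by rewrite divr_gt0.
exists (pickle s) => z w z1 w1; rewrite /base_poly pickleK.
have n0 : nm (0 : R[i]) <= 1 by rewrite nm0.
have /negPf -> : (gauss_poly s).[0%:P].[0] != 0.
  apply/eqP => h; have := sP 0 0 n0 n0; rewrite h subr0; lra.
have := nm_triangle P1.[w%:P].[z] P.[w%:P].[z] (gauss_poly s).[w%:P].[z].
by have := P1P z w; have := sP z w z1 w1; lra.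
Qed.

End GaussianRationals.

(* [TInv j] stands for 1 / p_j and [TSqrt t] for a chosen square root of t. *)
Inductive term : Type :=
  TZ | TW | TQ of rat * rat | TInv of nat | TAdd of term & term
| TMul of term & term | TSqrt of term.

(** * Countability of terms and finite towers of square roots *)

Module TermCount.
Fixpoint encode (t : term) : GenTree.tree (rat * rat + nat) :=
  match t with
  | TZ => GenTree.Node 0 [::]
  | TW => GenTree.Node 1 [::]
  | TQ c => GenTree.Leaf (inl c)
  | TInv j => GenTree.Leaf (inr j)
  | TAdd a b => GenTree.Node 2 [:: encode a; encode b]
  | TMul a b => GenTree.Node 3 [:: encode a; encode b]
  | TSqrt a => GenTree.Node 4 [:: encode a]
  end.

Fixpoint decode (t : GenTree.tree (rat * rat + nat)) : option term :=
  match t with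
  | GenTree.Node 0 _ => Some TZ
  | GenTree.Node 1 _ => Some TW
  | GenTree.Leaf (inl c) => Some (TQ c)
  | GenTree.Leaf (inr j) => Some (TInv j)
  | GenTree.Node 2 [:: a; b] =>
      if decode a is Some a' then if decode b is Some b' then Some (TAdd a' b')
      else None else None
  | GenTree.Node 3 [:: a; b] =>
      if decode a is Some a' then if decode b is Some b' then Some (TMul a' b')
      else None else None
  | GenTree.Node 4 [:: a] => if decode a is Some a' then Some (TSqrt a') else None
  | _ => None
  end.

Lemma encodeK : pcancel encode decode.
Proof. by elim=> //= [a -> b ->|a -> b ->|a ->]. Qed.
End TermCount.

HB.instance Definition _ := Countable.copy term (pcan_type TermCount.encodeK).

(* The square roots occurring in t are those of elements of L. *)
Fixpoint over (L : seq term) (t : term) : bool :=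
  match t with
  | TAdd a b | TMul a b => over L a && over L b
  | TSqrt a => (a \in L) && over L a
  | _ => true
  end.

(** The head is adjoined last: its own roots have radicands in the tail. Repetitions are allowed, so
    that towers can be concatenated. *)
Fixpoint wf_tower (L : seq term) : bool :=
  if L is a :: L' then over L' a && wf_tower L' else true.

Lemma over_sub L L' t : {subset L <= L'} -> over L t -> over L' t.
Proof.
move=> LL'; elim: t => //= [a IHa b IHb|a IHa b IHb|a IHa] /andP[].
- by move=> /IHa -> /IHb ->.
- by move=> /IHa -> /IHb ->.
- by move=> /LL' -> /IHa ->.
Qed.

Lemma wf_over L a : wf_tower L -> a \in L -> over L a.
Proof.
elim: L => //= b L IH /andP[bL wL]; rewrite in_cons => /predU1P[->|/(IH wL)].
  by apply: over_sub bL => x; rewrite in_cons orbC => ->.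
by apply: over_sub => x; rewrite in_cons orbC => ->.
Qed.

Lemma wf_tower_cat L L' : wf_tower L -> wf_tower L' -> wf_tower (L ++ L').
Proof.
elim: L => //= a L IH /andP[aL wL] wL'; rewrite IH // andbT.
by apply: over_sub aL => x; rewrite mem_cat => ->.
Qed.

Lemma over_tower t : exists2 L, wf_tower L & over L t.
Proof.
have cat a b : (exists2 L, wf_tower L & over L a) ->
    (exists2 L, wf_tower L & over L b) -> exists2 L, wf_tower L & over L a && over L b.
  move=> [L wL La] [L' wL' L'b]; exists (L ++ L'); first exact: wf_tower_cat.
  by rewrite (over_sub _ La) ?(over_sub _ L'b) // => x; rewrite mem_cat => ->; rewrite ?orbT.
elim: t => [||||a IHa b IHb|a IHa b IHb|a [L wL La]]; try by exists [::].
- exact: cat.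
- exact: cat.
- exists (a :: L); rewrite /= ?La ?wL // mem_head /=.
  by apply: over_sub La => x; rewrite in_cons orbC => ->.
Qed.

(** * Valuations of terms and the change of sign of one root *)

Section Valuations.
Variables (R : realType) (p : nat -> {poly {poly R[i]}}) (e : nat -> R).
Implicit Types (v : term -> R[i]) (z w : R[i]) (t : term).

(** A point of the infinite Cole extension: a base point of the bidisc with |p_j| >= e_j, and a
    consistent choice of square roots. The equations and bounds are closed conditions, as
    compactness requires. *)
Record valuation v : Prop := Valuation {
  val_Q : forall c, v (TQ c) = gauss R c;
  val_D : forall s t, v (TAdd s t) = v s + v t;
  val_M : forall s t, v (TMul s t) = v s * v t;
  val_sqrt : forall t, v (TSqrt t) ^+ 2 = v t;
  val_inv : forall j, v (TInv j) * (p j).[(v TW)%:P].[v TZ] = 1;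
  val_ge : forall j, e j <= nm (p j).[(v TW)%:P].[v TZ];
  val_Z : nm (v TZ) <= 1;
  val_W : nm (v TW) <= 1 }.

(** The root chosen by s may depend on the radicand as a term, so that two terms of equal value can
    receive opposite roots. *)
Fixpoint extend z w (s : term -> R[i] -> R[i]) (t : term) : R[i] :=
  match t with
  | TZ => z
  | TW => w
  | TQ c => gauss R c
  | TInv j => ((p j).[w%:P].[z])^-1
  | TAdd a b => extend z w s a + extend z w s b
  | TMul a b => extend z w s a * extend z w s b
  | TSqrt a => s a (extend z w s a)
  end.

Lemma valuation_extend z w s : (forall j, 0 < e j) -> nm z <= 1 -> nm w <= 1 ->
  (forall j, e j <= nm (p j).[w%:P].[z]) -> (forall a x, s a x ^+ 2 = x) ->
  valuation (extend z w s).
Proof.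
move=> e0 z1 w1 pe sK; split=> //= j.
by rewrite mulVf // -nm_gt0 (lt_le_trans (e0 j)).
Qed.

Lemma val_inv_eq v j : valuation v -> v (TInv j) = ((p j).[(v TW)%:P].[v TZ])^-1.
Proof.
move=> vv; have h := val_inv vv j.
have pn : (p j).[(v TW)%:P].[v TZ] != 0.
  by apply: contra_eq_neq h => ->; rewrite mulr0 eq_sym oner_neq0.
by apply: (mulIf pn); rewrite h mulVf.
Qed.

Lemma sqrt_swap v L a : (forall j, 0 < e j) -> valuation v ->
  wf_tower L -> a \notin L -> over L a ->
  exists v', [/\ valuation v', v' TZ = v TZ, v' TW = v TW,
    v' (TSqrt a) = - v (TSqrt a) & forall t, over L t -> v' t = v t].
Proof.
move=> e0 vv wL aL La.
(* The root of every radicand whose value is unchanged is kept, except that of a. Radicands altered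
   by the flip get the principal root; none of them occurs in a term over L. *)
pose s b x := if x == v b then (if b == a then - v (TSqrt b) else v (TSqrt b)) else sqrtC x.
pose v' := extend (v TZ) (v TW) s.
have agree t : over L t -> v' t = v t.
  elim: t => //= [c _|j _|b IHb c IHc|b IHb c IHc|b IHb].
  - by rewrite (val_Q vv).
  - by rewrite (val_inv_eq _ vv).
  - by move=> /andP[/IHb hb /IHc hc]; rewrite (val_D vv) -hb -hc.
  - by move=> /andP[/IHb hb /IHc hc]; rewrite (val_M vv) -hb -hc.
  move=> /andP[bL /IHb hb]; rewrite /v' /= -/v' hb /s eqxx.
  by case: eqVneq => // ba; rewrite -ba bL in aL.
exists v'; split=> //.
- apply: valuation_extend => //.
  + exact: val_Z.
  + exact: val_W.
  + exact: val_ge.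
  move=> b x; rewrite /s; case: eqVneq => [->|_]; last exact: sqrtCK.
  by case: ifP => _; rewrite ?sqrrN (val_sqrt vv).
- by rewrite /v' /= -/v' agree // /s !eqxx.
Qed.

(** As (sqrt a)^2 = a is over L, adjoining the root gives combinations of 1 and sqrt a. The terms b
    and c do not depend on the valuation, so both signs of the root can be compared. *)
Lemma sqrt_decomposition L a t : wf_tower L -> over L a -> over (a :: L) t ->
  exists b c, [/\ over L b, over L c &
    forall v, valuation v -> v t = v b + v c * v (TSqrt a)].
Proof.
move=> wL La.
have Q0 v : valuation v -> v (TQ (0, 0)) = 0.
  by move=> vv; rewrite (val_Q vv) gaussE /= rmorph0.
have Q1 v : valuation v -> v (TQ (1, 0)) = 1.
  by move=> vv; rewrite (val_Q vv) gaussE /= rmorph0 rmorph1.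
elim: t => [_|_|c _|j _|s IHs t IHt|s IHs t IHt|s _] /=; first 4 last.
- move=> /andP[/IHs[b [c [Lb Lc bc]]] /IHt[b' [c' [Lb' Lc' bc']]]].
  exists (TAdd b b'), (TAdd c c'); split; rewrite /= ?Lb ?Lc //.
  by move=> v vv; rewrite !(val_D vv) (bc _ vv) (bc' _ vv); ring.
- move=> /andP[/IHs[b [c [Lb Lc bc]]] /IHt[b' [c' [Lb' Lc' bc']]]].
  exists (TAdd (TMul b b') (TMul (TMul c c') a)), (TAdd (TMul b c') (TMul c b')).
  split; rewrite /= ?Lb ?Lc ?Lb' ?Lc' ?La //.
  move=> v vv; rewrite !(val_D vv, val_M vv) (bc _ vv) (bc' _ vv) -(val_sqrt vv a).
  by ring.
- rewrite in_cons => /andP[/predU1P[-> _|sL _]].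
    exists (TQ (0, 0)), (TQ (1, 0)); split=> // v vv.
    by rewrite Q0 // Q1 // add0r mul1r.
  exists (TSqrt s), (TQ (0, 0)); split=> //; first by rewrite /= sL wf_over.
  by move=> v vv; rewrite Q0 // mul0r addr0.
- by exists TZ, (TQ (0, 0)); split=> // v vv; rewrite Q0 // mul0r addr0.
- by exists TW, (TQ (0, 0)); split=> // v vv; rewrite Q0 // mul0r addr0.
- by exists (TQ c), (TQ (0, 0)); split=> // v vv; rewrite Q0 // mul0r addr0.
- by exists (TInv j), (TQ (0, 0)); split=> // v vv; rewrite Q0 // mul0r addr0.
Qed.

(** A term without roots is P / D with D a product of p_j's, bounded below by the product of the
    e_j's; d is the term for 1 / D. *)
Lemma base_fraction t : (forall j, 0 < e j) -> over [::] t ->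
  exists (P D : {poly {poly R[i]}}) (d : term) (r : R), [/\ 0 < r, over [::] d,
  (forall z w, (forall j, e j <= nm (p j).[w%:P].[z]) -> r <= nm D.[w%:P].[z]),
  (forall v, valuation v -> v d * D.[(v TW)%:P].[v TZ] = 1) &
  forall v, valuation v -> v t * D.[(v TW)%:P].[v TZ] = P.[(v TW)%:P].[v TZ]].
Proof.
move=> e0.
(* An opaque copy of the constant 1 keeps unification from evaluating it. *)
have [u u1] : exists u : {poly {poly R[i]}}, forall z w, u.[w%:P].[z] = 1.
  by exists 1 => z w; rewrite !hornerC.
have vQ1 v : valuation v -> v (TQ (1, 0)) = 1.
  by move=> vv; rewrite (val_Q vv) gaussE /= rmorph0 rmorph1.
pose fraction s := exists (P D : {poly {poly R[i]}}) (d : term) (r : R),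
  [/\ 0 < r, over [::] d,
  (forall z w, (forall j, e j <= nm (p j).[w%:P].[z]) -> r <= nm D.[w%:P].[z]),
  (forall v, valuation v -> v d * D.[(v TW)%:P].[v TZ] = 1) &
  forall v, valuation v -> v s * D.[(v TW)%:P].[v TZ] = P.[(v TW)%:P].[v TZ]].
rewrite -/(fraction t).
have cst s P : (forall v, valuation v -> v s = P.[(v TW)%:P].[v TZ]) -> fraction s.
  move=> sP; exists P, u, (TQ (1, 0)), 1; split=> [||z w _|v vv|v vv].
  - exact: ltr01.
  - by [].
  - by rewrite u1 nm1.
  - by rewrite u1 mulr1 vQ1.
  - by rewrite u1 mulr1 sP.
have mul2 (D D' : {poly {poly R[i]}}) d d' (r r' : R) : 0 < r -> 0 < r' ->
    (forall z w, (forall j, e j <= nm (p j).[w%:P].[z]) -> r <= nm D.[w%:P].[z]) ->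
    (forall z w, (forall j, e j <= nm (p j).[w%:P].[z]) -> r' <= nm D'.[w%:P].[z]) ->
    (forall v, valuation v -> v d * D.[(v TW)%:P].[v TZ] = 1) ->
    (forall v, valuation v -> v d' * D'.[(v TW)%:P].[v TZ] = 1) ->
    (forall z w, (forall j, e j <= nm (p j).[w%:P].[z]) ->
      r * r' <= nm (D * D').[w%:P].[z]) /\
    (forall v, valuation v -> v (TMul d d') * (D * D').[(v TW)%:P].[v TZ] = 1).
  move=> r0 r'0 rD rD' dD dD'; split=> [z w pe|v vv].
    by rewrite !hornerM nmM ler_pM ?rD ?rD' // ltW.
  by rewrite (val_M vv) !hornerM mulrACA dD // dD' // mulr1.
elim: t => [_|_|c _|j _|s IHs t IHt|s IHs t IHt|s _] //=.
- by apply: (cst _ 'X%:P) => v _; rewrite hornerC hornerX.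
- by apply: (cst _ 'X) => v _; rewrite hornerX hornerC.
- by apply: (cst _ (gauss R c)%:P%:P) => v vv; rewrite (val_Q vv) !hornerC.
- exists u, (p j), (TInv j), (e j); split=> // v vv; first exact: val_inv vv j.
  by rewrite (val_inv vv) u1.
- move=> /andP[/IHs[P [D [d [r [r0 od rD dD sP]]]]]].
  move=> /IHt[P' [D' [d' [r' [r'0 od' rD' dD' tP]]]]].
  have [rDD dDD] := mul2 _ _ _ _ _ _ r0 r'0 rD rD' dD dD'.
  exists (P * D' + P' * D), (D * D'), (TMul d d'), (r * r').
  split=> [||//|//|v vv]; [exact: mulr_gt0|by rewrite /= od|].
  by rewrite !(hornerD, hornerM) -(sP _ vv) -(tP _ vv) (val_D vv); ring.
move=> /andP[/IHs[P [D [d [r [r0 od rD dD sP]]]]]].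
move=> /IHt[P' [D' [d' [r' [r'0 od' rD' dD' tP]]]]].
have [rDD dDD] := mul2 _ _ _ _ _ _ r0 r'0 rD rD' dD dD'.
exists (P * P'), (D * D'), (TMul d d'), (r * r').
split=> [||//|//|v vv]; [exact: mulr_gt0|by rewrite /= od|].
by rewrite !hornerM -(sP _ vv) -(tP _ vv) (val_M vv); ring.
Qed.

Lemma val_bound t : (forall j, 0 < e j) ->
  exists2 M : R, 0 < M & forall v, valuation v -> nm (v t) <= M.
Proof.
move=> e0; elim: t => [||c|j|s [M M0 sM] t [N N0 tN]|s [M M0 sM] t [N N0 tN]|s [M M0 sM]].
- by exists 1 => // v vv; exact: val_Z vv.
- by exists 1 => // v vv; exact: val_W vv.
- exists (nm (gauss R c) + 1) => [|v vv]; first by rewrite ltr_wpDl ?nm_ge0.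
  by rewrite (val_Q vv) lerDl.
- exists (e j)^-1 => [|v vv]; first by rewrite invr_gt0.
  rewrite (val_inv_eq _ vv) nmV lef_pV2 ?posrE ?(val_ge vv) //.
  exact: lt_le_trans (e0 j) (val_ge vv j).
- exists (M + N) => [|v vv]; first exact: addr_gt0.
  by rewrite (val_D vv) (le_trans (nmD _ _)) // lerD ?sM ?tN.
- exists (M * N) => [|v vv]; first exact: mulr_gt0.
  by rewrite (val_M vv) nmM ler_pM ?nm_ge0 ?sM ?tN.
exists (M + 1) => [|v vv]; first by rewrite ltr_wpDl // ltW.
have := sM v vv; rewrite -(val_sqrt vv) nmX.
by have := nm_ge0 (v (TSqrt s)); nra.
Qed.

Definition boundary v := valuation v /\ (nm (v TZ) = 1 \/ nm (v TW) = 1).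

Fixpoint tpow t n := if n is n'.+1 then TMul t (tpow t n') else TQ (1, 0).

Lemma val_tpow v t n : valuation v -> v (tpow t n) = v t ^+ n.
Proof.
move=> vv; elim: n => [|n IH]; last by rewrite /= (val_M vv) IH exprS.
by rewrite /= (val_Q vv) gaussE /= rmorph0 rmorph1 expr0.
Qed.

Lemma over_tpow L t n : over L t -> over L (tpow t n).
Proof. by move=> Lt; elim: n => //= n ->; rewrite Lt. Qed.

End Valuations.

(** Since 2 (xy)^n = (x^n + y^n)^2 - (x^(2n) + y^(2n)), growth in n yields |xy| <= M^2. If |x| > M
    then |y| <= M, hence |x|^n <= 3 M^n for all n, which is absurd. This recovers a bound on one
    value from means over two signs. *)
Lemma nm_power_sum_le (R : realType) (x y : R[i]) (M : R) :
  (forall n, nm (x ^+ n + y ^+ n) <= 2 * M ^+ n) -> nm x <= M.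
Proof.
move=> h.
have M0 : 0 <= M.
  by have := h 1%N; rewrite !expr1; have := nm_ge0 (x + y); lra.
have xy : nm (x * y) <= M ^+ 2.
  have b n : nm (x * y) ^+ n <= 3 * (M ^+ 2) ^+ n.
    have E : (x ^+ n + y ^+ n) ^+ 2 - (x ^+ (n * 2) + y ^+ (n * 2)) = 2 * (x * y) ^+ n.
      by rewrite !exprM exprMn; ring.
    have h1 := h n; have h2 := h (n * 2)%N.
    have : nm (2 * (x * y) ^+ n) <= (2 * M ^+ n) ^+ 2 + 2 * M ^+ (n * 2).
      rewrite -E (le_trans (nmB _ _)) // lerD // nmX.
      by rewrite lerXn2r ?nnegrE ?nm_ge0 // mulr_ge0 // exprn_ge0.
    have nm2 : nm (2 : R[i]) = 2.
      by rewrite -[2](rmorph_nat (real_complex R)) nm_real normr_nat.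
    rewrite nmM nm2 nmX exprM (exprAC M 2); lra.
  rewrite leNgt; apply/negP => Mlt.
  have xy0 : 0 < nm (x * y) by apply: le_lt_trans Mlt; rewrite sqr_ge0.
  have [||k] := @exists_expr_lt R (M ^+ 2 / nm (x * y)) (1 / 3); last first.
  - rewrite expr_div_n ltr_pdivrMr ?exprn_gt0 //.
    by have := b k; lra.
  - by rewrite divr_gt0.
  by rewrite divr_ge0 ?sqr_ge0 ?nm_ge0 //= ltr_pdivrMr // mul1r.
rewrite leNgt; apply/negP => Mx.
have x0 : 0 < nm x by apply: le_lt_trans Mx.
have yM : nm y <= M.
  rewrite nmM in xy; rewrite -(ler_pM2l x0) (le_trans xy) // expr2.
  by rewrite ler_wpM2r // ltW.
have b n : nm x ^+ n <= 3 * M ^+ n.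
  have := nmB_ge (x ^+ n) (- y ^+ n); rewrite opprK nmN !nmX.
  have : nm y ^+ n <= M ^+ n by rewrite lerXn2r ?nnegrE ?nm_ge0.
  by have := h n; lra.
have [||k] := @exists_expr_lt R (M / nm x) (1 / 3); last first.
- rewrite expr_div_n ltr_pdivrMr ?exprn_gt0 //.
  by have := b k; lra.
- by rewrite divr_gt0.
by rewrite divr_ge0 ?nm_ge0 //= ltr_pdivrMr // mul1r.
Qed.

(** * The fibre over 0 lies in the hull of the boundary *)

Section FibreHull.
Variables (R : realType) (p : nat -> {poly {poly R[i]}}) (e : nat -> R).
Hypothesis e_gt0 : forall j, 0 < e j.
Hypothesis peaked : forall n, exists Q : {poly {poly R[i]}},
  forall z w i, nm z <= 1 -> nm w <= 1 -> (i < n)%N ->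
  nm (p i).[w%:P].[z] < e i -> nm Q.[w%:P].[z] < nm Q.[0%:P].[0].

(** At the point 0 itself, a violated threshold would give |Q(0)| < |Q(0)|. *)
Lemma threshold_at0 j : e j <= nm (p j).[0%:P].[0].
Proof.
have [Q QP] := peaked j.+1; rewrite leNgt; apply/negP => h.
have n0 : nm (0 : R[i]) <= 1 by rewrite nm0.
by have := QP 0 0 j n0 n0 (ltnSn j) h; rewrite ltxx.
Qed.

(* If t^n = b + c sqrt a, then b is the mean of t^n over the two signs of sqrt a. *)
Lemma fibre_hull L t v M : wf_tower L -> over L t ->
  valuation p e v -> v TZ = 0 -> v TW = 0 ->
  (forall b, boundary p e b -> nm (b t) <= M) -> nm (v t) <= M.
Proof.
move=> wL; elim: L wL t v M => [_|a L IH /= /andP[La wL]] t v M Lt vv vz vw bM.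
  have [P [D [_ [r [r0 _ rD _ tP]]]]] := base_fraction p e_gt0 Lt.
  have D0 : 0 < nm D.[0%:P].[0].
    by apply: lt_le_trans r0 (rD _ _ _) => j; exact: threshold_at0.
  have : nm P.[0%:P].[0] <= M * nm D.[0%:P].[0].
    apply: (base_hull peaked r0); first by rewrite -nm_gt0.
    move=> z w z1 w1 zw pe; split; last exact: rD.
    (* Principal roots lift the base point to a boundary valuation, where the bound on t is
       available. *)
    pose b := extend p z w (fun _ => sqrtC).
    have bv : valuation p e b by apply: valuation_extend => // _ x; exact: sqrtCK.
    have := tP _ bv; rewrite /= => <-; rewrite nmM ler_wpM2r ?nm_ge0 //.
    exact: bM.
  have := tP _ vv; rewrite vz vw => <-.
  by rewrite nmM ler_pM2r.
have [aL|aL] := boolP (a \in L).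
  apply: (IH wL t v M _ vv vz vw bM); apply: over_sub Lt => x.
  by rewrite in_cons => /predU1P[->|].
have [v' [vv' v'z v'w v's v'L]] := sqrt_swap e_gt0 vv wL aL La.
apply: (@nm_power_sum_le _ _ (v' t)) => n.
have [b [c [Lb Lc bc]]] := sqrt_decomposition p e wL La (over_tpow n Lt).
have sumE u u' : valuation p e u -> valuation p e u' -> u' (TSqrt a) = - u (TSqrt a) ->
    (forall s, over L s -> u' s = u s) -> u t ^+ n + u' t ^+ n = 2 * u b.
  move=> uv u'v u's u'L; rewrite -(val_tpow t n uv) -(val_tpow t n u'v).
  by rewrite (bc _ uv) (bc _ u'v) u's !u'L //; ring.
have nm2 : nm (2 : R[i]) = 2.
  by rewrite -[2](rmorph_nat (real_complex R)) nm_real normr_nat.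
rewrite (sumE _ _ vv vv' v's v'L) nmM nm2 ler_pM2l //.
apply: (IH wL b v _ Lb vv vz vw) => u [uv ubd].
have [u' [uv' u'z u'w u's u'L]] := sqrt_swap e_gt0 uv wL aL La.
rewrite -(@ler_pM2l _ 2) // -[X in X * _]nm2 -nmM -(sumE _ _ uv uv' u's u'L).
have ub : boundary p e u by [].
have ub' : boundary p e u' by split=> //; rewrite u'z u'w.
rewrite (le_trans (nmD _ _)) // !nmX mulrDl mul1r.
by rewrite lerD // lerXn2r ?nnegrE ?nm_ge0 ?bM // (le_trans _ (bM _ ub)) // nm_ge0.
Qed.

End FibreHull.

(** * Inverses and square roots in uniformly closed algebras of bounded functions *)

Section ClosedSubalgebra.
Variables (R : realType) (T : Type).
Implicit Types (f g : T -> R[i]) (S : (T -> R[i]) -> Prop).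

(** Stated for predicates on functions over a bare type, so as to apply both to closures of sets of
    terms and to the elements of a uniform algebra. *)
Record closed_subalgebra S : Prop := ClosedSubalgebra {
  cs_cst : forall c, S (fun _ => c);
  cs_add : forall f g, S f -> S g -> S (fun x => f x + g x);
  cs_mul : forall f g, S f -> S g -> S (fun x => f x * g x);
  cs_bounded : forall f, S f -> exists2 M : R, 0 < M & forall x, nm (f x) <= M;
  cs_closed : forall f, (forall d : R, 0 < d -> exists2 g, S g &
    forall x, nm (f x - g x) <= d) -> S f }.

Definition invertible_in S f := exists2 u, S u & forall x, u x * f x = 1.

Definition dense_invertibles S := forall f, S f -> forall d : R, 0 < d ->
  exists g, [/\ S g, invertible_in S g & forall x, nm (f x - g x) <= d].

Variable S : (T -> R[i]) -> Prop.
Hypothesis HS : closed_subalgebra S.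

Lemma cs_opp f : S f -> S (fun x => - f x).
Proof.
move=> Sf; have := cs_mul HS (cs_cst HS (-1)) Sf.
by congr S; apply/funext => x; rewrite mulN1r.
Qed.

Lemma cs_sub f g : S f -> S g -> S (fun x => f x - g x).
Proof. by move=> Sf Sg; exact: cs_add (cs_opp Sg). Qed.

Lemma cs_exp f n : S f -> S (fun x => f x ^+ n).
Proof.
move=> Sf; elim: n => [|n IH]; first exact: cs_cst.
by have := cs_mul HS Sf IH; congr S; apply/funext => x; rewrite exprS.
Qed.

Lemma cs_inv_1B f (r : R) : S f -> 0 <= r < 1 -> (forall x, nm (f x) <= r) ->
  S (fun x => (1 - f x)^-1).
Proof.
move=> Sf r01 fr; have [r0 r1] := andP r01.
apply: (cs_closed HS) => d d0.
have r1' : 0 < 1 - r by rewrite subr_gt0.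
have [n nd] := exists_expr_lt r01 (mulr_gt0 d0 r1').
exists (fun x => \sum_(i < n) f x ^+ i).
  elim: n {nd} => [|n IH].
    by have := cs_cst HS 0; congr S; apply/funext => x; rewrite big_ord0.
  have := cs_add HS IH (cs_exp n Sf); congr S; apply/funext => x.
  by rewrite big_ord_recr.
move=> x.
have f1 : 1 - r <= nm (1 - f x).
  by have := nmB_ge 1 (f x); rewrite nm1; have := fr x; lra.
have f0 : 1 - f x != 0 by rewrite -nm_gt0; lra.
have -> : (1 - f x)^-1 - \sum_(i < n) f x ^+ i = (1 - f x)^-1 * f x ^+ n.
  apply: (mulfI f0); rewrite mulrBr mulrA divff // mul1r.
  have -> : (1 - f x) * (\sum_(i < n) f x ^+ i) = - (f x ^+ n - 1).
    by rewrite subrX1 -mulNr opprB.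
  by rewrite opprK addrC subrK.
rewrite nmM nmV nmX.
rewrite mulrC ler_pdivrMr ?nm_gt0 //.
apply: (@le_trans _ _ (d * (1 - r))); last by rewrite ler_pM2l.
by rewrite (le_trans _ (ltW nd)) // lerXn2r ?nnegrE ?nm_ge0.
Qed.

Lemma invertible_near h : S h -> invertible_in S h -> exists2 d : R, 0 < d &
  forall f, S f -> (forall x, nm (h x - f x) <= d) -> invertible_in S f.
Proof.
move=> Sh [u Su uh]; have [M M0 uM] := cs_bounded HS Su.
have d0 : 0 < 1 / 2 / M by rewrite divr_gt0.
exists (1 / 2 / M) => // f Sf hf.
pose g x := u x * (h x - f x).
have Sg : S g by apply: (cs_mul HS Su); exact: cs_sub.
have g2 x : nm (g x) <= 1 / 2.
  rewrite nmM; have -> : 1 / 2 = M * (1 / 2 / M) :> R by field; lra.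
  by rewrite ler_pM ?nm_ge0.
exists (fun x => (1 - g x)^-1 * u x).
  by apply: (cs_mul HS _ Su); apply: (cs_inv_1B Sg _ g2); lra.
move=> x; have g0 : 1 - g x != 0.
  rewrite -nm_gt0; have := nmB_ge 1 (g x); rewrite nm1; have := g2 x; lra.
have E : u x * f x = 1 - g x by rewrite /g mulrBr uh; ring.
by rewrite -mulrA E mulVf.
Qed.

(* Newton-like iteration r' = r + (1 + f - r^2) / 2 for the square root of 1 + f. *)
Lemma approx_sqrt f (d : R) : S f -> 0 < d <= 1 / 8 -> (forall x, nm (f x) <= d) ->
  forall t, 0 < t -> exists r, [/\ S r, forall x, nm (r x - 1) <= d &
    forall x, nm (1 + f x - r x ^+ 2) <= t].
Proof.
move=> Sf /andP[d0 d8] fd t t0.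
(* The error halves at each step, and the corrections d / 2, d / 4, ... add up to less than d, which
   keeps r within d of 1. *)
have it n : exists r, [/\ S r, forall x, nm (r x - 1) <= d - d * (1 / 2) ^+ n &
    forall x, nm (1 + f x - r x ^+ 2) <= d * (1 / 2) ^+ n].
  elim: n => [|n [r [Sr r1 rf]]].
    exists (fun _ => 1); split=> [|x|x]; first exact: cs_cst.
      by rewrite subrr nm0 expr0 mulr1 subrr.
    by rewrite expr1n addrAC subrr add0r expr0 mulr1.
  exists (fun x => r x + 2^-1 * (1 + f x - r x ^+ 2)).
  have nm2 : nm (2^-1 : R[i]) = 1 / 2.
    by rewrite nmV -[2](rmorph_nat (real_complex R)) nm_real normr_nat mul1r.
  have hn : 0 <= (1 / 2) ^+ n :> R by rewrite exprn_ge0.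
  have hn1 : (1 / 2) ^+ n <= 1 :> R by rewrite exprn_ile1 //; lra.
  have dn : 0 <= d * (1 / 2) ^+ n by rewrite mulr_ge0 // ltW.
  have dn1 : d * (1 / 2) ^+ n <= d by rewrite ler_piMr // ltW.
  split=> [|x|x].
  - apply: (cs_add HS Sr); apply: (cs_mul HS (cs_cst HS _)).
    by apply: cs_sub (cs_exp _ Sr); exact: (cs_add HS (cs_cst HS 1) Sf).
  - rewrite addrAC (le_trans (nmD _ _)) // nmM nm2.
    rewrite (exprS (1 / 2)).
    by have := r1 x; have := rf x; lra.
  set y := 1 + f x - r x ^+ 2.
  (* The factor (r - 1) + y / 4 has modulus at most 1 / 2 because d <= 1 / 8. *)
  have -> : 1 + f x - (r x + 2^-1 * y) ^+ 2 = - y * ((r x - 1) + 2^-1 * 2^-1 * y).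
    by rewrite /y; field.
  rewrite nmM nmN (exprS (1 / 2)) mulrCA mulrC ler_pM ?nm_ge0 ?rf //.
  rewrite (le_trans (nmD _ _)) // !nmM nm2.
  by have := r1 x; have := rf x; rewrite -/y; lra.
have [|n nt] := @exists_expr_lt R (1 / 2) t _ t0; first by lra.
have [r [Sr r1 rf]] := it n; exists r; split=> // x.
  rewrite (le_trans (r1 x)) // lerBlDr lerDl mulr_ge0 ?exprn_ge0 //; lra.
apply: (le_trans (rf x)); apply: le_trans (ltW nt); rewrite ler_piMl ?exprn_ge0 //; lra.
Qed.

(* The norm of s + b y is s^2 - b^2 f.  On an invertible s0 the map s |-> s^2
   is open, so s can be chosen near a with s^2 - b^2 f invertible. *)
Lemma invertible_norm a b f (d : R) : dense_invertibles S -> S a -> S b -> S f ->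
  0 < d -> exists s, [/\ S s, invertible_in S (fun x => s x ^+ 2 - b x ^+ 2 * f x) &
    forall x, nm (a x - s x) <= d].
Proof.
move=> dS Sa Sb Sf d0; have d2 : 0 < d / 2 by rewrite divr_gt0.
have [s0 [Ss0 [u Su us0] as0]] := dS _ Sa _ d2.
have [M M0 sM] := cs_bounded HS Ss0; have [N N0 uN] := cs_bounded HS Su.
pose g x := s0 x ^+ 2 - b x ^+ 2 * f x.
have Sg : S g by exact: (cs_sub (cs_exp 2 Ss0) (cs_mul HS (cs_exp 2 Sb) Sf)).
have p8 : 0 < 1 / 8 :> R by lra.
have [e e0 [e8 eM _]] := exists_pos_le3 p8 (divr_gt0 d2 M0) d2.
have N2 : 0 < N ^+ 2 by rewrite exprn_gt0.
have [h [Sh hi gh]] := dS _ Sg _ (divr_gt0 e0 N2).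
have [c c0 near_h] := invertible_near Sh hi.
(* As u s0 = 1, s0^2 (1 + x0) - b^2 f is exactly the invertible h. Replacing 1 + x0 by the square of
   an approximate root r stays in the neighbourhood of h where invertibility persists. *)
pose x0 x := u x ^+ 2 * (h x - g x).
have Sx0 : S x0 by exact: (cs_mul HS (cs_exp 2 Su) (cs_sub Sh Sg)).
have x0e x : nm (x0 x) <= e.
  rewrite nmM nmX nm_dist; have -> : e = N ^+ 2 * (e / N ^+ 2) by field; lra.
  by rewrite ler_pM ?exprn_ge0 ?nm_ge0 ?gh // lerXn2r ?nnegrE ?nm_ge0 // ltW.
have M2 : 0 < M ^+ 2 by rewrite exprn_gt0.
have [|r [Sr r1 rx]] := approx_sqrt Sx0 _ x0e (divr_gt0 c0 M2); first by rewrite e0.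
exists (fun x => s0 x * r x); split=> [||x]; first exact: cs_mul.
  apply: near_h.
    exact: (cs_sub (cs_exp 2 (cs_mul HS Ss0 Sr)) (cs_mul HS (cs_exp 2 Sb) Sf)).
  move=> x; have -> : h x - ((s0 x * r x) ^+ 2 - b x ^+ 2 * f x) =
      s0 x ^+ 2 * (1 + x0 x - r x ^+ 2).
    have us : u x ^+ 2 * s0 x ^+ 2 = 1 by rewrite -exprMn us0 expr1n.
    rewrite /x0 mulrBr mulrDr mulr1 mulrA [s0 x ^+ 2 * _]mulrC us mul1r /g exprMn.
    by ring.
  rewrite nmM nmX; have -> : c = M ^+ 2 * (c / M ^+ 2) by field; lra.
  by rewrite ler_pM ?exprn_ge0 ?nm_ge0 ?rx // lerXn2r ?nnegrE ?nm_ge0 // ltW.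
apply: (le_trans (nm_triangle (s0 x) _ _)).
have -> : s0 x - s0 x * r x = - s0 x * (r x - 1) by ring.
rewrite nmM nmN; have : nm (s0 x) * nm (r x - 1) <= M * (d / 2 / M).
  by rewrite ler_pM ?nm_ge0 // (le_trans (r1 x)).
have -> : M * (d / 2 / M) = d / 2 by field; lra.
by have := as0 x; lra.
Qed.

End ClosedSubalgebra.

(** * Density of invertibles and of squares in the closure of the terms *)

Section TermAlgebra.
Variables (R : realType) (e : nat -> R) (T : Type) (ev : T -> term -> R[i]).
Hypothesis e_gt0 : forall j, 0 < e j.
Hypothesis evP : forall x, valuation (@base_poly R) e (ev x).
Local Notation p := (@base_poly R).

Definition approx (U : pred term) (f : T -> R[i]) : Prop :=
  forall d : R, 0 < d -> exists2 t, U t & forall x, nm (f x - ev x t) <= d.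

Lemma approx_term (U : pred term) t : U t -> approx U (ev^~ t).
Proof. by move=> Ut d d0; exists t => // x; rewrite subrr nm0 ltW. Qed.

Lemma approxW (U U' : pred term) f : {subset U <= U'} -> approx U f -> approx U' f.
Proof. by move=> UU' fU d /fU[t /UU' Ut tf]; exists t. Qed.

Lemma approx_bounded (U : pred term) f : approx U f -> exists2 M : R, 0 < M & forall x, nm (f x) <= M.
Proof.
move=> /(_ _ ltr01)[t _ ft]; have [M M0 tM] := @val_bound R p e t e_gt0.
exists (1 + M) => [|x]; first exact: addr_gt0.
have := nm_triangle (ev x t) (f x) 0; rewrite !subr0.
by have := ft x; have := tM _ (evP x); lra.
Qed.

Lemma approx_closed_subalgebra (U : pred term) :
  (forall c, U (TQ c)) -> (forall s t, U s -> U t -> U (TAdd s t)) ->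
  (forall s t, U s -> U t -> U (TMul s t)) -> closed_subalgebra (approx U).
Proof.
move=> UQ UD UM; split.
- move=> c d d0; have [q cq] := gauss_dense c d0; exists (TQ q) => // x.
  by rewrite (val_Q (evP x)).
- move=> f g Uf Ug d d0; have d2 : 0 < d / 2 by rewrite divr_gt0.
  have [s Us fs] := Uf _ d2; have [t Ut gt] := Ug _ d2.
  exists (TAdd s t); [exact: UD|move=> x].
  rewrite (val_D (evP x)) opprD addrACA (le_trans (nmD _ _)) //.
  by have := fs x; have := gt x; lra.
- move=> f g Uf Ug d d0; have [M M0 fM] := approx_bounded Uf.
  have d1 : 0 < d / 2 / M by rewrite !divr_gt0.
  have [t Ut gt] := Ug _ d1; have [N N0 tN] := @val_bound R p e t e_gt0.
  have d3 : 0 < d / 2 / N by rewrite !divr_gt0.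
  have [s Us fs] := Uf _ d3.
  exists (TMul s t); [exact: UM|move=> x]; rewrite (val_M (evP x)).
  have -> : f x * g x - ev x s * ev x t =
    f x * (g x - ev x t) + (f x - ev x s) * ev x t by ring.
  rewrite (le_trans (nmD _ _)) // !nmM.
  have -> : d = M * (d / 2 / M) + d / 2 / N * N by field; lra.
  by rewrite lerD // ler_pM ?nm_ge0 // tN.
- exact: approx_bounded.
- move=> f fU d d0; have d2 : 0 < d / 2 by rewrite divr_gt0.
  have [g Ug fg] := fU _ d2; have [t Ut gt] := Ug _ d2.
  exists t => // x; rewrite (le_trans (nm_triangle (g x) _ _)) //.
  by have := fg x; have := gt x; lra.
Qed.

Lemma over_closed_subalgebra L : closed_subalgebra (approx (over L)).
Proof. by apply: approx_closed_subalgebra => //= s t -> ->. Qed.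

Lemma term_closed_subalgebra : closed_subalgebra (approx xpredT).
Proof. exact: approx_closed_subalgebra. Qed.

Lemma approx_poly (P : {poly {poly R[i]}}) :
  approx (over [::]) (fun x => P.[(ev x TW)%:P].[ev x TZ]).
Proof.
have cs := over_closed_subalgebra [::].
have approx1 (q : {poly R[i]}) : approx (over [::]) (fun x => q.[ev x TZ]).
  elim/poly_ind: q => [|q c IH].
    have := cs_cst cs 0; congr approx; apply/funext => x.
    by rewrite horner0.
  have := cs_add cs (cs_mul cs IH (approx_term (t := TZ) isT)) (cs_cst cs c).
  by congr approx; apply/funext => x; rewrite hornerMXaddC.
elim/poly_ind: P => [|P c IH].
  have := cs_cst cs 0; congr approx; apply/funext => x.
  by rewrite !horner0.
have := cs_add cs (cs_mul cs IH (approx_term (t := TW) isT)) (approx1 c).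
by congr approx; apply/funext => x; rewrite hornerMXaddC hornerD hornerM hornerC.
Qed.

(** Write t = P / D and replace P by a nearby p_j; the inverse of p_j / D is D times the value of
    [TInv j]. *)
Lemma dense_invertibles_base : dense_invertibles (approx (over [::])).
Proof.
move=> f Uf d d0; have d2 : 0 < d / 2 by rewrite divr_gt0.
have cs := over_closed_subalgebra [::].
have [t Lt ft] := Uf _ d2.
have [P [D [a [r [r0 La rD aD tP]]]]] := base_fraction p e_gt0 Lt.
have [M M0 aM] := @val_bound R p e a e_gt0.
have dM : 0 < d / 2 / M by rewrite divr_gt0.
have [j Pj] := base_poly_dense P dM.
exists (fun x => (p j).[(ev x TW)%:P].[ev x TZ] * ev x a); split.
- exact: (cs_mul cs (approx_poly (p j)) (approx_term La)).
- exists (fun x => ev x (TInv j) * D.[(ev x TW)%:P].[ev x TZ]).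
    exact: (cs_mul cs (approx_term (t := TInv j) isT) (approx_poly D)).
  move=> x; rewrite mulrACA (val_inv (evP x)) mul1r mulrC; exact: aD.
move=> x; have tE : ev x t = P.[(ev x TW)%:P].[ev x TZ] * ev x a.
  by rewrite -(tP _ (evP x)) -mulrA [D.[_].[_] * _]mulrC (aD _ (evP x)) mulr1.
rewrite (le_trans (nm_triangle (ev x t) _ _)) // tE -mulrBl nmM -tE.
have : nm (P.[(ev x TW)%:P].[ev x TZ] - (p j).[(ev x TW)%:P].[ev x TZ]) *
    nm (ev x a) <= d / 2 / M * M.
  by rewrite ler_pM ?nm_ge0 ?aM // Pj //; [exact: val_Z (evP x)|exact: val_W (evP x)].
have -> : d / 2 / M * M = d / 2 by field; lra.
by have := ft x; lra.
Qed.

(** In t = b + c sqrt a only b is moved, to an s with s^2 - c^2 a invertible; the conjugate s - c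
    sqrt a then provides the inverse. *)
Lemma dense_invertibles_tower L : wf_tower L -> dense_invertibles (approx (over L)).
Proof.
elim: L => [_|a L IH /= /andP[La wL]]; first exact: dense_invertibles_base.
have cs := over_closed_subalgebra L; have cs' := over_closed_subalgebra (a :: L).
have sub : {subset over L <= over (a :: L)}.
  by move=> t; apply: over_sub => x; rewrite in_cons orbC => ->.
have ysub : over (a :: L) (TSqrt a).
  by rewrite /= mem_head /=; exact: sub.
move=> f Uf d d0; have d2 : 0 < d / 2 by rewrite divr_gt0.
have [t Lt ft] := Uf _ d2.
have [b [c [Lb Lc bc]]] := sqrt_decomposition p e wL La Lt.
have [s [Us [v Uv vs] bs]] := invertible_norm cs (IH wL) (approx_term Lb)
  (approx_term Lc) (approx_term La) d2.
have Us' := approxW sub Us; have Uv' := approxW sub Uv.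
have Uc' := approxW sub (approx_term Lc); have Uy := approx_term ysub.
exists (fun x => s x + ev x c * ev x (TSqrt a)); split.
- exact: (cs_add cs' Us' (cs_mul cs' Uc' Uy)).
- exists (fun x => v x * (s x - ev x c * ev x (TSqrt a))).
    exact: (cs_mul cs' Uv' (cs_sub cs' Us' (cs_mul cs' Uc' Uy))).
  move=> x; rewrite -(vs x) -(val_sqrt (evP x) a); ring.
move=> x; rewrite (le_trans (nm_triangle (ev x t) _ _)) // (bc _ (evP x)).
rewrite [X in _ + nm X](_ : _ = ev x b - s x); last by ring.
by rewrite -(bc _ (evP x)); have := ft x; have := bs x; lra.
Qed.

Lemma term_dense_invertibles : dense_invertibles (approx xpredT).
Proof.
move=> f Uf d d0; have d2 : 0 < d / 2 by rewrite divr_gt0.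
have [t _ ft] := Uf _ d2; have [L wL Lt] := over_tower t.
have [g [Ug [u Uu ug] tg]] := dense_invertibles_tower wL (approx_term Lt) d2.
exists g; split; first exact: approxW Ug.
  by exists u => //; exact: approxW Uu.
move=> x; rewrite (le_trans (nm_triangle (ev x t) _ _)) //.
by have := ft x; have := tg x; lra.
Qed.

Lemma term_dense_squares f (d : R) : approx xpredT f -> 0 < d ->
  exists2 h, approx xpredT h & forall x, nm (f x - h x ^+ 2) <= d.
Proof.
move=> Uf d0; have [t _ ft] := Uf _ d0; exists (ev^~ (TSqrt t)).
  exact: approx_term.
by move=> x; rewrite (val_sqrt (evP x)).
Qed.

End TermAlgebra.

(** * The uniform topology in terms of the real modulus *)

Section UniformTopology.
Variables (R : realType) (X : choiceType).
Local Notation C := (R[i]^o).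

Lemma uniform_nbhs_nm (f : {uniform X -> C}) (P : set {uniform X -> C}) :
  nbhs f P <-> exists2 d : R, 0 < d & forall h, (forall x, nm (f x - h x) <= d) -> P h.
Proof.
rewrite uniform_nbhs; split=> [[E [entE EP]]|[d d0 dP]].
  move: entE; rewrite -entourage_ballE => -[c /=].
  rewrite ltcE => /andP[/eqP cI c0] cE.
  have d0 : 0 < complex.Re c / 2 by rewrite divr_gt0.
  exists (complex.Re c / 2) => // h fh; apply: EP => x _; apply: cE => /=.
  rewrite -ball_normE /= nm_normE ltcE /= cI eqxx /=.
  by apply: (le_lt_trans (fh x)); move: c0 => /=; lra.
have dC : 0 < d%:C%C :> R[i] by rewrite ltcR.
exists [set xy : C * C | ball xy.1 d%:C%C xy.2]; split.
  by have := @entourage_ball _ C (PosNum dC).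
move=> h fh; apply: dP => x.
by have := fh x I; rewrite -ball_normE /= nm_normE ltcR => /ltW.
Qed.

Lemma closed_uniformP (S : set {uniform X -> C}) : closed S <->
  forall f : X -> C, (forall d : R, 0 < d -> exists2 g, S g &
    forall x, nm (f x - g x) <= d) -> S f.
Proof.
split=> [cS f fS|h f clf].
  apply: cS => U /uniform_nbhs_nm[d d0 dU].
  by have [g Sg fg] := fS d d0; exists g; split=> //; exact: dU.
apply: h => d d0.
have [|g [Sg gf]] := clf [set g | forall x, nm (f x - g x) <= d].
  by apply/uniform_nbhs_nm; exists d.
by exists g.
Qed.

End UniformTopology.

(** * Characters and Gleason parts of a uniform algebra *)

Section UniformAlgebraTheory.
Variables (R : realType) (X : topologicalType) (A : uniform_algebra R X).
Hypothesis cX : compact [set: X].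
Local Notation C := (R[i]^o).

Lemma ua_nm_continuous (f : X -> C) : f \in ua_pred A -> continuous (fun x => nm (f x)).
Proof.
move=> Af x; apply: (continuous_comp (g := @nm R : C -> R)).
  exact: ua_continuous Af x.
exact: nm_continuous.
Qed.

Lemma ua_max (f : X -> C) (K : set X) : f \in ua_pred A -> closed K -> K !=set0 ->
  exists2 x, K x & forall y, K y -> nm (f y) <= nm (f x).
Proof.
move=> Af cK K0.
have cpK : compact K by apply: (subclosed_compact cK cX).
have [|x /set_mem Kx xM] := @compact_EVT_max _ R (fun x => nm (f x)) K K0 cpK.
  by apply: continuous_subspaceT; exact: ua_nm_continuous.
by exists x => // y Ky; apply: xM; exact: mem_set.
Qed.

Lemma ua_closed_subalgebra : closed_subalgebra (fun f : X -> R[i] => f \in ua_pred A).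
Proof.
have A0 : (0 : X -> C) \in ua_pred A by rewrite rpred0.
split.
- move=> c; have -> : (fun _ => c) = c *: (1 : X -> C).
    by apply/funext => x; exact: (esym (mulr1 c)).
  exact: rpredZ (ua_one A).
- by move=> f g Af Ag; exact: (rpredD Af Ag).
- by move=> f g Af Ag; exact: (rpredM Af Ag).
- move=> f Af; have [X0|/set0P X0] := eqVneq [set: X] set0.
    exists 1 => // x; exfalso.
    by have : [set: X] x by []; rewrite X0.
  have [x _ xM] := ua_max Af closedT X0.
  exists (nm (f x) + 1); first by rewrite ltr_wpDl ?nm_ge0.
  by move=> y; have := xM y I; lra.
move=> f fA; have h := iffLR (closed_uniformP _) (@ua_closed _ _ A).
apply: h.
by move=> d /fA[g Ag fg]; exists g.
Qed.

Let cs := ua_closed_subalgebra.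

Section Character.
Variable phi : ua_type A -> C.
Hypothesis phi_char : character_space A phi.

Lemma char_lin (a : R[i]) (f g : ua_type A) : phi (a *: f + g) = a * phi f + phi g.
Proof. by case: phi_char => + _ _; apply. Qed.

Lemma char_mul f g : phi (f * g) = phi f * phi g.
Proof. by case: phi_char => _ + _; apply. Qed.

Lemma char_one : phi 1 = 1.
Proof.
have [f f0] : exists f, phi f <> 0.
  apply: contrapT => h; case: phi_char => _ _; apply; apply/funext => f.
  by apply: contrapT => f0; apply: h; exists f.
by apply: (mulfI (introN eqP f0)); rewrite -char_mul !mulr1.
Qed.

Lemma char_zero : phi 0 = 0.
Proof.
have := char_lin 1 0 0; rewrite scale1r addr0 mul1r => h.
by apply: (addrI (phi 0)); rewrite -h addr0.
Qed.

Lemma char_add f g : phi (f + g) = phi f + phi g.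
Proof. by rewrite -[f]scale1r char_lin mul1r scale1r. Qed.

Lemma char_scale a f : phi (a *: f) = a * phi f.
Proof. by rewrite -[a *: f]addr0 char_lin char_zero addr0. Qed.

Lemma char_sub f g : phi (f - g) = phi f - phi g.
Proof. by rewrite char_add -scaleN1r char_scale mulN1r. Qed.

(** Automatic continuity: if |phi f| > M, then 1 - f / phi f is invertible by the Neumann series,
    although phi sends it to 0. *)
Lemma char_le (f : ua_type A) (M : R) : 0 <= M -> (forall x, nm (f x) <= M) ->
  nm (phi f) <= M.
Proof.
move=> M0 fM; rewrite leNgt; apply/negP => lt.
have p0 : 0 < nm (phi f) by apply: le_lt_trans lt.
have p0' : phi f != 0 by rewrite -nm_gt0.
pose h : ua_type A := (phi f)^-1 *: f.
have hr x : nm (h x) <= M / nm (phi f).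
  by rewrite nmM nmV mulrC ler_pM2r ?invr_gt0 // fM.
have r01 : 0 <= M / nm (phi f) < 1.
  by rewrite divr_ge0 ?nm_ge0 //= ltr_pdivrMr // mul1r.
have Ai := cs_inv_1B cs (valP h) r01 hr.
have E : (1 - h) * UAType Ai = 1.
  apply/val_inj/funext => x /=.
  have : 1 - h x != 0.
    have /andP[_ r1] := r01.
    by rewrite -nm_gt0; have := nmB_ge 1 (h x); rewrite nm1; have := hr x; lra.
  by move=> h0; exact: (mulfV h0).
have := congr1 phi E; rewrite char_mul char_sub char_one char_scale mulVf //.
by rewrite subrr mul0r => /eqP; rewrite eq_sym oner_eq0.
Qed.

End Character.

Section Gleason.
Hypothesis dense_squares : forall f : X -> R[i], f \in ua_pred A -> forall d : R, 0 < d ->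
  exists2 h : X -> R[i], h \in ua_pred A & forall x, nm (f x - h x ^+ 2) <= d.

Lemma ua_sqrt (f : ua_type A) (d : R) : 0 < d ->
  exists h : ua_type A, forall x, nm ((f - h * h) x) <= d.
Proof.
move=> d0; have [h Ah fh] := dense_squares (valP f) d0.
by exists (UAType Ah).
Qed.

Lemma ua_bounded (f : ua_type A) : exists2 M : R, 0 < M & forall x, nm (f x) <= M.
Proof. exact: (cs_bounded cs (valP f)). Qed.

Definition shift (c : R[i]) (f : ua_type A) : ua_type A :=
  f - c *: (1 : ua_type A).

Lemma shiftE c f x : shift c f x = f x - c.
Proof. by congr (_ - _); exact: mulr1. Qed.

Lemma char_shift chi c f : character_space A chi -> chi (shift c f) = chi f - c.
Proof. by move=> h; rewrite (char_sub h) (char_scale h) (char_one h) mulr1. Qed.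

(* The supremum m of |phi g| over the unit ball of the kernel of psi satisfies
   m^2 >= m, because an approximate square root of g is almost in this ball. *)
Lemma separate_characters phi psi (c : R) : character_space A phi ->
  character_space A psi -> phi <> psi -> c < 1 ->
  exists g : ua_type A, [/\ forall x, nm (g x) <= 1, psi g = 0 & c < nm (phi g)].
Proof.
move=> phic psic phipsi c1.
pose E : set R := [set nm (phi g) | g in
  [set g : ua_type A | (forall x, nm (g x) <= 1) /\ psi g = 0]].
have E1 x : E x -> x <= 1.
  by move=> [g [g1 _] <-]; apply: char_le phic _ _ _ g1.
have [x0 Ex0 x00] : exists2 x, E x & 0 < x.
  have [f f0] : exists f, phi f != psi f.
    apply: contrapT => h; apply: phipsi; apply/funext => f; apply/eqP.
    by apply: contrapT => f0; apply: h; exists f; apply/negP.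
  pose g := shift (psi f) f.
  have [M M0 gM] := ua_bounded g.
  exists (nm (phi ((M^-1)%:C%C *: g))).
    exists ((M^-1)%:C%C *: g) => //; split.
      move=> x; rewrite nmM nm_real ger0_norm ?invr_ge0 ?(ltW M0) //.
      by rewrite mulrC ler_pdivrMr // mul1r gM.
    by rewrite (char_scale psic) char_shift // subrr mulr0.
  rewrite (char_scale phic) char_shift //.
  rewrite nm_gt0 mulf_neq0 ?subr_eq0 //.
  by rewrite -nm_gt0 nm_real normr_gt0 invr_eq0 gt_eqF.
have supE : has_sup E by split; [exists x0|exists 1; exact: E1].
pose m := sup E.
have mE x : E x -> x <= m by move=> Ex; exact: (sup_upper_bound supE Ex).
have m0 : 0 < m by apply: lt_le_trans (mE _ Ex0).
have m1 : m <= 1 by apply: ge_sup; [exists x0|exact: E1].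
(* If |g - h^2| <= d^2, then |psi h| <= d and (h - psi h) / (1 + 2 d) lies in the ball, so |phi h|
   <= m + 3 d. As m and d are at most 1, (m + 3 d)^2 + d^2 <= m^2 + 16 d. *)
have sq x : E x -> forall d : R, 0 < d <= 1 -> x <= m ^+ 2 + 16 * d.
  move=> [g [g1 psig] <-] d /andP[d0 d1].
  have d20 : 0 < d ^+ 2 by rewrite exprn_gt0.
  have [h gh] := ua_sqrt g d20.
  have phigh chi : character_space A chi -> nm (chi g - chi h ^+ 2) <= d ^+ 2.
    move=> chic; rewrite expr2 -(char_mul chic) -(char_sub chic).
    by apply: char_le chic _ _ (ltW d20) gh.
  have h1 y : nm (h y) <= 1 + d.
    have := gh y; rewrite /= => ghy.
    have : nm (h y) ^+ 2 <= 1 + d ^+ 2.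
      rewrite -nmX; have := nm_triangle (g y) (h y ^+ 2) 0; rewrite !subr0.
      rewrite nm_dist expr2 => /le_trans; apply; rewrite addrC lerD //.
    by have := nm_ge0 (h y); nra.
  have psih : nm (psi h) <= d.
    have := phigh psi psic; rewrite psig sub0r nmN nmX.
    by rewrite ler_pXn2r ?nnegrE ?nm_ge0 ?(ltW d0).
  pose k : ua_type A := ((1 + 2 * d)^-1)%:C%C *: shift (psi h) h.
  have d2 : 0 < 1 + 2 * d by lra.
  have Ek : E (nm (phi k)).
    exists k => //; split; last by rewrite (char_scale psic) char_shift // subrr mulr0.
    move=> y; have -> : k y = ((1 + 2 * d)^-1)%:C%C * (h y - psi h) by rewrite -shiftE.
    rewrite nmM nm_real ger0_norm ?invr_ge0 ?(ltW d2) //.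
    rewrite mulrC ler_pdivrMr // mul1r (le_trans (nmB _ _)) //.
    by have := h1 y; lra.
  have := mE _ Ek; rewrite (char_scale phic) char_shift //.
  rewrite nmM nm_real ger0_norm ?invr_ge0 ?(ltW d2) // mulrC ler_pdivrMr //.
  have := nmB_ge (phi h) (psi h) => hh kk.
  have ph : nm (phi h) <= m + 3 * d.
    have : m * (2 * d) <= 1 * (2 * d) by rewrite ler_wpM2r //; lra.
    lra.
  have : nm (phi h) ^+ 2 <= (m + 3 * d) ^+ 2.
    by rewrite lerXn2r ?nnegrE ?nm_ge0 //; lra.
  have := phigh phi phic; have := nm_triangle (phi h ^+ 2) (phi g) 0; rewrite !subr0 nmX.
  have : d ^+ 2 <= d by rewrite expr2 ler_piMr // ltW.
  have : m * d <= d by rewrite ler_piMl // ltW.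
  by rewrite sqrrD; lra.
have mm : m <= m ^+ 2.
  apply: ge_sup => [|x Ex]; first by exists x0.
  apply/ler_addgt0Pl => eps eps0.
  have e16 : 0 < eps / 16 by rewrite divr_gt0.
  have [d d0 [d1 de _]] := exists_pos_le3 (@ltr01 R) e16 e16.
  have : 0 < d <= 1 by rewrite d0.
  by move=> /(sq x Ex); lra.
have m1' : m = 1.
  by apply/eqP; rewrite eq_le m1 /= -(ler_pM2l m0) mulr1 -expr2.
have [|x Ex cx] := @sup_adherent _ _ (1 - c) _ supE; first by rewrite subr_gt0.
move: cx; rewrite -/m m1' opprB addrCA subrr addr0.
by move: Ex => [g [g1 pg] <-]; exists g.
Qed.

Lemma sup_norm_le (K : set X) (f : X -> C) (M : R) :
  (sup_norm K f <= M%:E)%E <-> forall x, K x -> nm (f x) <= M.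
Proof.
split=> [h x Kx|h].
  by rewrite -lee_fin; apply: le_trans h; apply: ereal_sup_ubound; exists x.
by apply: ge_ereal_sup => _ [x Kx <-]; rewrite lee_fin h.
Qed.

Lemma dual_norm_bound (L : ua_type A -> C) : (dual_norm L < 2%:E)%E ->
  exists2 s : R, 0 <= s < 2 &
    forall f : ua_type A, (forall x, nm (f x) <= 1) -> nm (L f) <= s.
Proof.
move=> L2.
have Lf (f : ua_type A) : (forall x, nm (f x) <= 1) -> ((nm (L f))%:E <= dual_norm L)%E.
  move=> f1; apply: ereal_sup_ubound; exists f => //=.
  by apply/sup_norm_le => x _.
have L0 : (0 <= dual_norm L)%E.
  apply: le_trans (Lf 0 _); first by rewrite lee_fin nm_ge0.
  by move=> x; rewrite nm0 ler01.
case: (dual_norm L) L0 L2 Lf => [s| |] //; rewrite lee_fin lte_fin => s0 s2 Lf.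
by exists s; rewrite ?s0 // => f /Lf; rewrite lee_fin.
Qed.

(* For psi g = 0 and phi g = c near 1, the Moebius transform
   k = (a - g) / (1 - a g) has |phi k - psi k| = c (1 - a^2) / (1 - a c). *)
Lemma gleason_part_singleton phi : character_space A phi ->
  gleason_part A phi = [set phi].
Proof.
move=> phic; rewrite eqEsubset; split=> psi /=; last first.
  move=> ->; split=> //; rewrite subrr.
  apply: (@le_lt_trans _ _ 0%E); last by rewrite lte_fin.
  by apply: ge_ereal_sup => _ [f _ <-] /=; rewrite lee_fin nm0.
move=> [psic /dual_norm_bound[s /andP[s0 s2] sP]].
apply/eqP; rewrite eq_sym; apply/negPn/negP => /eqP phipsi.
pose a := s / 2.
have a0 : 0 <= a by rewrite divr_ge0.
have a1 : a < 1 by rewrite /a; lra.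
have aa : 0 < 1 + a ^+ 2 by rewrite ltr_wpDr // sqr_ge0.
(* The condition c > 2 a / (1 + a^2) is equivalent to c (1 - a^2) / (1 - a c) > 2 a = s, the
   inequality that contradicts the bound s. *)
have c1 : 2 * a / (1 + a ^+ 2) < 1.
  by rewrite ltr_pdivrMr // mul1r; nra.
have [g0 [g01 psig0 phig0]] := separate_characters phic psic phipsi c1.
pose c := nm (phi g0).
have c0 : 0 < c.
  by apply: le_lt_trans phig0; rewrite divr_ge0 ?mulr_ge0 // ltW.
have cle : c <= 1 by apply: char_le phic _ _ _ g01.
have p0 : phi g0 != 0 by rewrite -nm_gt0.
(* A rotation makes phi g the positive real c. *)
pose g : ua_type A := (c%:C%C / phi g0) *: g0.
have g1 x : nm (g x) <= 1.
  rewrite nmM nmM nm_real nmV -/c ger0_norm ?(ltW c0) // divff ?gt_eqF // mul1r.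
  exact: g01.
have psig : psi g = 0 by rewrite (char_scale psic) psig0 mulr0.
have phig : phi g = c%:C%C by rewrite (char_scale phic) divfK.
pose ag : ua_type A := a%:C%C *: g.
have ag1 x : nm (ag x) <= a.
  by rewrite nmM nm_real ger0_norm // ler_piMr ?g1.
have a01 : 0 <= a < 1 by rewrite a0.
have Ai := cs_inv_1B cs (valP ag) a01 ag1.
have ag0 x : 1 - ag x != 0.
  by rewrite -nm_gt0; have := nmB_ge 1 (ag x); rewrite nm1; have := ag1 x; lra.
pose k : ua_type A := (- shift a%:C%C g) * UAType Ai.
have kE x : k x = - (g x - a%:C%C) * (1 - ag x)^-1 by rewrite -shiftE.
have kmul : k * (- shift 1 ag) = - shift a%:C%C g.
  apply/val_inj/funext => x.
  have e1 : (- shift a%:C%C g) x = - (g x - a%:C%C) by rewrite -shiftE.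
  have e2 : (k * (- shift 1 ag)) x = k x * - (ag x - 1) by rewrite -shiftE.
  apply: (etrans e2); apply: etrans (esym e1).
  by rewrite kE (opprB (ag x) 1) mulfVK.
have charN chi f : character_space A chi -> chi (- f) = - chi f.
  by move=> h; rewrite -sub0r (char_sub h) (char_zero h) sub0r.
have kchi chi : character_space A chi -> chi k * (1 - a%:C%C * chi g) = a%:C%C - chi g.
  move=> h; have := congr1 chi kmul.
  by rewrite (char_mul h) !charN // !char_shift // (char_scale h) !opprB.
(* This rests on |1 - a g|^2 - |a - g|^2 = (1 - a^2) (1 - |g|^2) for real a. *)
have k1 x : nm (k x) <= 1.
  rewrite kE nmM nmN nmV ler_pdivrMr ?nm_gt0 // mul1r.
  rewrite -(@ler_pXn2r _ 2) ?nnegrE ?nm_ge0 //.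
  have -> : ag x = a%:C%C * g x by [].
  have : nm (g x) ^+ 2 <= 1 by rewrite exprn_ile1 ?nm_ge0.
  rewrite !nm_sqr; case: (g x) => u v /=.
  rewrite !(mul0r, mulr0, subr0, addr0, add0r, sub0r) => uv.
  have : 0 <= (1 - a ^+ 2) * (1 - (u ^+ 2 + v ^+ 2)).
    by rewrite mulr_ge0 // subr_ge0 // expr_le1 // ltW.
  by nra.
have := sP k k1; rewrite /=.
have psik : psi k = a%:C%C.
  by have := kchi psi psic; rewrite psig mulr0 !subr0 mulr1.
have := kchi phi phic; rewrite phig => phik.
have E : (phi k - psi k) * (1 - a * c)%:C%C = - (c * (1 - a ^+ 2))%:C%C.
  rewrite mulrBl psik rmorphB /= rmorphM /= rmorph1 phik.
  by rewrite !(rmorphM, rmorphB, rmorphXn, rmorph1) /=; ring.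
move=> /(ler_wpM2r (nm_ge0 (1 - a * c)%:C%C)).
have -> : (phi - psi) k = phi k - psi k by [].
have ac : 0 <= 1 - a * c by rewrite subr_ge0 mulr_ile1 // ltW.
have a2 : 0 <= 1 - a ^+ 2 by rewrite subr_ge0 expr_le1 // ltW.
rewrite -nmM E nmN !nm_real !ger0_norm // ?mulr_ge0 ?(ltW c0) // => h.
move: phig0; rewrite -/c ltr_pdivrMr //.
by move: h; rewrite (_ : s = 2 * a); [nra|rewrite /a; field].
Qed.

End Gleason.
End UniformAlgebraTheory.

(* [compact_cover] is stated for pointed spaces only. *)
Lemma compact_cover_inhabited (X : topologicalType) (x : X) (K : set X) :
  compact K -> cover_compact K.
Proof.
pose pX := isPointed.Build X x; pose Xp : ptopologicalType := HB.pack X pX.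
move=> cK; have E := @compact_cover Xp.
by have : (compact : set Xp -> Prop) K by []; rewrite E.
Qed.

(** * Existence of the Shilov boundary *)

Section ShilovBoundary.
Variables (R : realType) (X : topologicalType) (A : uniform_algebra R X).
Hypothesis cX : compact [set: X].
Hypothesis X0 : [set: X] !=set0.
Local Notation C := (R[i]^o).
Let cs := ua_closed_subalgebra A cX.

Definition maximum_set (K : set X) := forall f : X -> C, f \in ua_pred A ->
  forall M : R, (forall x, K x -> nm (f x) <= M) -> forall x, nm (f x) <= M.

Lemma maximum_set_neq0 K : maximum_set K -> K !=set0.
Proof.
move=> Kmax; apply/set0P/eqP => K0; have [x _] := X0.
have : nm ((1 : X -> C) x) <= 0.
  by apply: (Kmax 1 (ua_one A)) => y; rewrite K0.
by rewrite nm1 ler10.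
Qed.

(** A negative bound on K forces K to be empty, and then the function 1 with the bound 0 contradicts
    the hypothesis. *)
Lemma maximum_setI (K : set X) : (forall f : X -> C, f \in ua_pred A ->
  forall M : R, 0 <= M -> (forall x, K x -> nm (f x) <= M) -> forall x, nm (f x) <= M) ->
  maximum_set K.
Proof.
move=> h f Af M fM x; have [M0|M0] := leP 0 M; first exact: (h f Af M M0 fM).
have : nm ((1 : X -> C) x) <= 0.
  apply: (h 1 (ua_one A)) => // y Ky.
  by have := le_lt_trans (fM y Ky) M0; rewrite ltNge nm_ge0.
by rewrite nm1 ler10.
Qed.

Lemma is_boundaryP K : is_boundary A K <-> closed K /\ maximum_set K.
Proof.
split=> [[cK K0 Ksup]|[cK Kmax]].
  split=> // f Af M /sup_norm_le KM x.
  have /sup_norm_le : (sup_norm setT f <= M%:E)%E by rewrite -(Ksup (UAType Af)).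
  exact.
have K0 := maximum_set_neq0 Kmax.
split=> // f; apply/eqP; rewrite eq_le; apply/andP; split.
  by apply: ereal_sup_le => _ [x _ <-]; exists x.
have [x Kx xM] := ua_max cX (valP f) cK K0.
apply: (@le_trans _ _ (nm (f x))%:E).
  by apply/sup_norm_le => y _; apply: (Kmax f (valP f)).
by apply: ereal_sup_ubound; exists x.
Qed.

(* If some maximum set K1 misses the set where all |g_y| <= 1, then the points
   where all |g_y| < 1 may be removed from any maximum set K: otherwise some
   f with max |f| = N is smaller than N on the rest of K, so
   |f^n g_y| <= N^n on K for large n, hence |f| < N on K1. *)
Lemma maximum_set_remove (D : seq X) (g : X -> X -> C) (K1 K : set X) :
  (forall y, y \in D -> g y \in ua_pred A) ->
  closed K1 -> maximum_set K1 ->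
  (forall x, K1 x -> exists2 y, y \in D & 1 < nm (g y x)) ->
  closed K -> maximum_set K ->
  let K' := K `&` [set x | exists2 y, y \in D & 1 <= nm (g y x)] in
  closed K' /\ maximum_set K'.
Proof.
move=> gA cK1 mK1 K1g cK mK K'; split.
  apply: closedI => //.
  have -> : [set x | exists2 y, y \in D & 1 <= nm (g y x)] =
      \bigcup_(y in [set` D]) (fun x => nm (g y x)) @^-1` [set r | 1 <= r].
    by apply/seteqP; split=> [x [y yD h]|x [y yD h]]; exists y.
  apply: closed_bigcup => [|y yD]; first exact: finite_seq.
  apply: preimage_closed; last exact: closed_ge.
  by move=> x _; apply: (ua_nm_continuous (gA y yD)).
apply: maximum_setI => f Af r r0 fr x; rewrite leNgt; apply/negP => rx.
have [x1 _ x1M] := ua_max cX Af closedT X0.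
pose N := nm (f x1).
have rN : r < N by rewrite (lt_le_trans rx) // x1M.
have N0 : 0 < N by apply: le_lt_trans rN.
have [B B0 gB] : exists2 B : R, 0 < B & forall y x, y \in D -> nm (g y x) <= B.
  have : forall s : seq X, (forall y, y \in s -> g y \in ua_pred A) ->
      exists2 B : R, 0 < B & forall y x, y \in s -> nm (g y x) <= B.
    elim=> [_|y s IH sA]; first by exists 1.
    have [|B B0 sB] := IH; first by move=> z zs; apply: sA; rewrite in_cons zs orbT.
    have [B' B'0 yB'] := cs_bounded cs (sA y (mem_head _ _)).
    exists (B + B') => [|z w]; first exact: addr_gt0.
    rewrite in_cons => /predU1P[->|/sB h]; first by have := yB' w; lra.
    by have := h w; lra.
  by move=> /(_ D gA).
have rN01 : 0 <= r / N < 1 by rewrite divr_ge0 ?(ltW N0) //= ltr_pdivrMr // mul1r.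
have [|n nP] := exists_expr_lt rN01 (_ : 0 < 1 / B); first by rewrite divr_gt0.
(* The exponent is [n.+1] because the final comparison of powers, also where f vanishes, requires a
   positive one. *)
have nP' : r ^+ n.+1 * B <= N ^+ n.+1.
  have : (r / N) ^+ n.+1 <= 1 / B.
    apply: le_trans (ltW nP); have /andP[q0 q1] := rN01.
    by rewrite exprS ler_piMl ?exprn_ge0 // ltW.
  by rewrite expr_div_n ler_pdivrMr ?exprn_gt0 // mulrAC mul1r ler_pdivlMr.
have fg y z : y \in D -> nm (f z) ^+ n.+1 * nm (g y z) <= N ^+ n.+1.
  move=> yD; rewrite -nmX -nmM.
  apply: (mK (fun z => f z ^+ n.+1 * g y z)).
    exact: (cs_mul cs (cs_exp cs n.+1 Af) (gA y yD)).
  move=> w Kw; rewrite nmM nmX.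
  have [[y' y'D h]|h] := pselect (exists2 y, y \in D & 1 <= nm (g y w)).
    have fw : nm (f w) <= r by apply: fr; split=> //; exists y'.
    apply: le_trans nP'; apply: ler_pM; rewrite ?exprn_ge0 ?nm_ge0 ?gB //.
    by rewrite lerXn2r ?nnegrE ?nm_ge0.
  rewrite -[leRHS]mulr1; apply: ler_pM; rewrite ?exprn_ge0 ?nm_ge0 //.
    by rewrite lerXn2r ?nnegrE ?nm_ge0 ?(ltW N0) // x1M.
  by rewrite leNgt; apply/negP => gw; apply: h; exists y => //; exact: ltW.
have [z K1z zM] := ua_max cX Af cK1 (maximum_set_neq0 mK1).
have := mK1 f Af (nm (f z)) zM x1; rewrite leNgt => /negP; apply.
have [y yD gy] := K1g z K1z.
rewrite -(@ltr_pXn2r _ n.+1) ?nnegrE ?nm_ge0 // ?(ltW N0) //.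
have [->|fz0] := eqVneq (nm (f z)) 0.
  by rewrite expr0n /= exprn_gt0.
apply: lt_le_trans (fg y z yD); rewrite -[ltLHS]mulr1 ltr_pM2l // exprn_gt0 //.
by rewrite lt_neqAle eq_sym fz0 nm_ge0.
Qed.

(* A closed set and a point outside it are separated by finitely many functions
   of A: this is where compactness and separation of points enter. *)
Lemma ua_neighbourhood (K : set X) x : closed K -> ~ K x ->
  exists (D : seq X) (g : X -> X -> C),
    [/\ forall y, y \in D -> g y \in ua_pred A,
       forall y, y \in D -> g y x = 0 &
       forall z, K z -> exists2 y, y \in D & 1 < nm (g y z)].
Proof.
move=> cK nKx.
have /choice[g gP] : forall y, exists f : X -> C,
    K y -> [/\ f \in ua_pred A, f x = 0 & 1 < nm (f y)].
  move=> y; have [Ky|nKy] := pselect (K y); last by exists 0.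
  have xy : x <> y by move=> E; rewrite E in nKx.
  have [f Af fxy] := ua_separates A xy.
  have fyx : f y - f x != 0 by rewrite subr_eq0 eq_sym; apply/eqP.
  exists (fun z => 2 / (f y - f x) * (f z - f x)) => _; split.
  - exact: (cs_mul cs (cs_cst cs (2 / (f y - f x))) (cs_sub cs Af (cs_cst cs (f x)))).
  - by rewrite subrr mulr0.
  rewrite divfK // -[2](rmorph_nat (real_complex R)) nm_real normr_nat.
  by rewrite ltr1n.
have cpK : compact K by apply: (subclosed_compact cK cX).
have := compact_cover_inhabited x cpK; move=> /(_ X K (fun y => [set z | 1 < nm (g y z)])).
case=> [y Ky|y Ky|D DK KD].
- have [Agy _ _] := gP y Ky.
  have h := iffLR (continuousP _) (ua_nm_continuous Agy).
  by apply: (h [set r | 1 < r]); exact: open_gt.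
- by exists y => //; have [] := gP y Ky.
have KE y : y \in finmap.enum_fset D -> K y by move=> /DK /set_mem.
exists (finmap.enum_fset D), g; split=> [y /KE Ky|y /KE Ky|z /KD[y yD h]].
- by have [] := gP y Ky.
- by have [] := gP y Ky.
- by exists y.
Qed.

(** The intersection G of all boundaries works. If |f| <= M on G but |f x| > M, the compact set
    where |f| >= |f x| misses G, so finitely many removable open sets cover it. Removing them from X
    leaves a boundary on which f cannot attain its maximum. *)
Lemma shilov_boundary_exists : exists G, is_shilov_boundary A G.
Proof.
pose G := \bigcap_(K in [set K | is_boundary A K]) K.
exists G; split; last by move=> K bK x; apply.
have cG : closed G by apply: closed_bigI => K [].
apply/is_boundaryP; split=> //; apply: maximum_setI => f Af M M0 fM x.
rewrite leNgt; apply/negP => Mx.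
pose F := [set z | nm (f x) <= nm (f z)].
have cF : closed F.
  apply: (@preimage_closed _ _ (fun z => nm (f z)) [set r | nm (f x) <= r]).
    by move=> z _; exact: ua_nm_continuous Af z.
  exact: closed_ge.
have cpF : compact F by apply: (subclosed_compact cF cX).
have /choice[V VP] : forall y, exists V : set X, F y ->
    [/\ open V, V y & forall K, closed K -> maximum_set K ->
      closed (K `\` V) /\ maximum_set (K `\` V)].
  move=> y; have [Fy|nFy] := pselect (F y); last by exists set0.
  have [K1 bK1 nK1y] : exists2 K1, is_boundary A K1 & ~ K1 y.
    apply: contrapT => h.
    have Gy : G y.
      by move=> K bK; apply: contrapT => nKy; apply: h; exists K.
    by have := fM y Gy; rewrite leNgt (lt_le_trans Mx Fy).
  have [cK1 mK1] := iffLR (is_boundaryP K1) bK1.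
  have [D [g [gA gy K1g]]] := ua_neighbourhood cK1 nK1y.
  pose W := [set z | exists2 y, y \in D & 1 <= nm (g y z)].
  exists (~` W) => _; split.
  - rewrite openC; have -> : W = \bigcup_(y in [set` D]) (fun x => nm (g y x)) @^-1` [set r | 1 <= r].
      by apply/seteqP; split=> [z [u uD h]|z [u uD h]]; exists u.
    apply: closed_bigcup => [|u uD]; first exact: finite_seq.
    apply: preimage_closed; last exact: closed_ge.
    by move=> z _; apply: (ua_nm_continuous (gA u uD)).
  - by move=> [u uD]; rewrite gy // nm0 ler10.
  move=> K cK mK; rewrite setDE setCK.
  exact: (maximum_set_remove gA cK1 mK1 K1g cK mK).
have := compact_cover_inhabited x cpF; move=> /(_ X F V).
case=> [y Fy|y Fy|D DF FD]; first by have [] := VP y Fy.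
  by exists y => //; have [] := VP y Fy.
have rem (s : seq X) : {subset s <= F} -> exists2 K, closed K /\ maximum_set K &
    forall y, y \in s -> K `&` V y = set0.
  elim: s => [_|y s IH sF]; first by exists setT => //; split=> // h Ah r hr z; exact: hr.
  have [|K [cK mK] Ks] := IH; first by move=> z zs; apply: sF; rewrite in_cons zs orbT.
  have Fy : F y by apply: set_mem; apply: sF; exact: mem_head.
  have [_ _ /(_ K cK mK) KV] := VP y Fy; exists (K `\` V y) => // z.
  rewrite in_cons => /predU1P[->|/Ks Kz]; first by rewrite setDE -setIA setICl setI0.
  by apply/seteqP; split=> // u [[Ku _] Vu]; rewrite -Kz.
have [K [cK mK] KD] := rem (finmap.enum_fset D) DF.
have [z Kz zM] := ua_max cX Af cK (maximum_set_neq0 mK).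
have : F z by exact: (mK f Af (nm (f z)) zM x).
move=> /FD[y yD Vyz].
have : (K `&` V y) z by [].
by rewrite KD.
Qed.

End ShilovBoundary.

(** * The compact metric space of valuations in the hull *)

Section HullSpace.
Variables (R : realType) (e : nat -> R).
Local Notation C := (R[i]^o).
Local Notation p := (@base_poly R).

(** Domination by the boundary is part of the definition of the space, so the boundary is a maximum
    set by construction; what needs proof is that some point lies over 0. *)
Definition in_hull (v : term -> C) := valuation p e v /\
  forall t M, (forall b, boundary p e b -> nm (b t) <= M) -> nm (v t) <= M.

Record hull_point := HullPoint { hull_val :> term -> C; hull_valP : in_hull hull_val }.

HB.instance Definition _ := gen_eqMixin hull_point.
HB.instance Definition _ := gen_choiceMixin hull_point.

Implicit Types x y z : hull_point.

Lemma hull_point_eq x y : (forall t, x t = y t) -> x = y.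
Proof.
case: x y => [v hv] [w hw] /= /funext vw; subst w.
by congr HullPoint; exact: Prop_irrelevance.
Qed.

Definition weight (t : term) : R := (1 / 2) ^+ pickle t.

Lemma weight_gt0 t : 0 < weight t.
Proof. by rewrite exprn_gt0. Qed.

Lemma weight_le1 t : weight t <= 1.
Proof. by rewrite exprn_ile1 //; lra. Qed.

Definition coord_dist x y t := weight t * Num.min 1 (nm (x t - y t)).

(** A weighted supremum over the countably many terms; truncation at 1 and weights tending to 0 make
    it a metric for pointwise convergence. *)
Definition hull_dist x y : R := sup (range (coord_dist x y)).

Lemma coord_dist_le1 x y t : coord_dist x y t <= 1.
Proof.
rewrite mulr_ile1 ?weight_le1 ?(ltW (weight_gt0 t)) ?ge_min ?lexx //.
by rewrite le_min ler01 nm_ge0.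
Qed.

Lemma has_sup_coord_dist x y : has_sup (range (coord_dist x y)).
Proof.
split; first by exists (coord_dist x y TZ); exists TZ.
by exists 1 => _ [t _ <-]; exact: coord_dist_le1.
Qed.

Lemma coord_dist_le x y t : coord_dist x y t <= hull_dist x y.
Proof. by apply: (sup_upper_bound (has_sup_coord_dist x y)); exists t. Qed.

Lemma hull_dist_le x y (M : R) : (forall t, coord_dist x y t <= M) -> hull_dist x y <= M.
Proof.
move=> h; apply: ge_sup; first by case: (has_sup_coord_dist x y).
by move=> _ [t _ <-].
Qed.

Lemma coord_dist_ge0 x y t : 0 <= coord_dist x y t.
Proof. by rewrite mulr_ge0 ?(ltW (weight_gt0 t)) // le_min ler01 nm_ge0. Qed.

Lemma hull_distxx x : hull_dist x x = 0.
Proof.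
apply/eqP; rewrite eq_le; apply/andP; split.
  apply: hull_dist_le => t.
  by rewrite /coord_dist subrr nm0 min_r ?ler01 // mulr0.
by apply: le_trans (coord_dist_le x x TZ); exact: coord_dist_ge0.
Qed.

Lemma hull_dist_eq0 x y : hull_dist x y = 0 -> x = y.
Proof.
move=> xy0; apply: hull_point_eq => t; apply/eqP; rewrite -subr_eq0 -nm_eq0.
have := coord_dist_le x y t; rewrite xy0 pmulr_rle0 ?weight_gt0 //.
by rewrite ge_min ler10 /= eq_le nm_ge0 andbT.
Qed.

Lemma hull_dist_sym x y : hull_dist x y = hull_dist y x.
Proof.
by congr sup; apply/seteqP; split=> _ [t _ <-]; exists t => //;
  rewrite /coord_dist nm_dist.
Qed.

Lemma hull_dist_triangle y x z : hull_dist x z <= hull_dist x y + hull_dist y z.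
Proof.
apply: hull_dist_le => t.
apply: (@le_trans _ _ (coord_dist x y t + coord_dist y z t)); last first.
  by rewrite lerD ?coord_dist_le.
rewrite /coord_dist -mulrDr ler_pM2l ?weight_gt0 //.
have := nm_triangle (y t) (x t) (z t); have := nm_ge0 (x t - y t).
have := nm_ge0 (y t - z t); rewrite /Num.min.
by do 3!case: ifPn => //; rewrite -?leNgt; lra.
Qed.

HB.instance Definition _ := isMetric.Build R hull_point
  hull_distxx hull_dist_eq0 hull_dist_sym hull_dist_triangle.

Lemma near_coord x t (d : R) : 0 < d ->
  nbhs x [set y : hull_point | nm (x t - y t) < d].
Proof.
move=> d0; have r0 : 0 < weight t * Num.min 1 d.
  by rewrite mulr_gt0 ?weight_gt0 // lt_min ltr01.
near=> y.
have : ball x (weight t * Num.min 1 d) y by near: y; exact: (@nbhsx_ballx _ hull_point).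
rewrite ballEmdist /= => /(le_lt_trans (coord_dist_le x y t)).
rewrite /coord_dist ltr_pM2l ?weight_gt0 // lt_min => /andP[].
by rewrite !gt_min ltxx /= => xy1 /orP[/(lt_trans xy1)|].
Unshelve. all: by end_near. Qed.


Hypothesis e_gt0 : forall j, 0 < e j.

Local Notation P := {ptws term -> C}.

Lemma coord_continuous_prod t : continuous ((fun v => v t) : P -> C).
Proof. exact: (@proj_continuous term (fun _ => C) t). Qed.

Lemma near_coords (v : P) (d : R) n : 0 < d ->
  nbhs v [set u : P | forall t, (pickle t < n)%N -> nm (v t - u t) < d].
Proof.
move=> d0; elim: n => [|n IH]; first exact: filterS filterT.
have : nbhs v [set u : P | forall t, pickle t = n -> nm (v t - u t) < d].
  case E : (unpickle n : option term) => [s|].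
    have vs : nbhs v [set u : P | nm (v s - u s) < d].
      exact: (@coord_continuous_prod s v _ (near_nm (v s) d0)).
    apply: (filterS _ vs) => u us t tn; rewrite -tn pickleK in E.
    by case: E => ->.
  by apply: filterS filterT => u _ t tn; move: E; rewrite -tn pickleK.
move: IH; apply: filterS2 => u un un' t.
by rewrite ltnS leq_eqVlt => /predU1P[/un'|/un].
Qed.

Lemma closed_eq_fun (T : topologicalType) (f g : T -> C) :
  continuous f -> continuous g -> closed [set v | f v = g v].
Proof.
move=> cf cg.
have -> : [set v | f v = g v] = (fun v => nm (f v - g v)) @^-1` [set r | r <= 0].
  apply/seteqP; split=> v /=; first by move=> ->; rewrite subrr nm0.
  by move=> h; apply/eqP; rewrite -subr_eq0 -nm_eq0 eq_le h nm_ge0.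
apply: preimage_closed; last exact: closed_le.
move=> v _; apply: (continuous_comp (f := fun v => f v - g v : C) (g := @nm R : C -> R)).
  by apply: cvgB; [exact: cf|exact: cg].
exact: nm_continuous.
Qed.

Lemma closed_nm_le (T : topologicalType) (f : T -> C) (M : R) :
  continuous f -> closed [set v | nm (f v) <= M].
Proof.
move=> cf; apply: (@preimage_closed _ _ (fun v => nm (f v)) [set r | r <= M]).
  move=> v _; apply: (continuous_comp (g := @nm R : C -> R)); first exact: cf.
  exact: nm_continuous.
exact: closed_le.
Qed.

Lemma closed_nm_ge (T : topologicalType) (f : T -> C) (M : R) :
  continuous f -> closed [set v | M <= nm (f v)].
Proof.
move=> cf; apply: (@preimage_closed _ _ (fun v => nm (f v)) [set r | M <= r]).
  move=> v _; apply: (continuous_comp (g := @nm R : C -> R)); first exact: cf.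
  exact: nm_continuous.
exact: closed_ge.
Qed.

(** Each defining condition involves finitely many coordinates and is closed. The hypothesis says
    that v is in the closure, in the form in which cluster points supply it. *)
Lemma closed_in_hull (v : P) :
  (forall E : set P, closed E -> (in_hull : set P) `<=` E -> E v) -> in_hull v.
Proof.
move=> cl; have cc := coord_continuous_prod.
have cp j : continuous (fun u : P => (p j).[(u TW)%:P].[u TZ] : C).
  move=> u; apply: (continuous_comp (f := fun u : P => (u TZ, u TW))
    (g := fun x : C * C => (p j).[x.2%:P].[x.1] : C)).
    exact: (cvg_pair (cc TZ u) (cc TW u)).
  exact: (bounded_lipschitz_continuous (bounded_lipschitz_poly (p j))).
have cM (f g : P -> C) : continuous f -> continuous g -> continuous (fun u => f u * g u : C).
  by move=> cf cg u; exact: (cvgM (cf u) (cg u)).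
have ct (c : C) : continuous (cst c : P -> C) by exact: cst_continuous.
split; first split.
- move=> c; apply: (cl [set u : P | u (TQ c) = gauss R c]).
    exact: (closed_eq_fun (cc (TQ c)) (ct (gauss R c))).
  by move=> u [uv _]; exact: (val_Q uv c).
- move=> s t; apply: (cl [set u : P | u (TAdd s t) = u s + u t]).
    apply: (closed_eq_fun (cc (TAdd s t)) (g := fun u : P => u s + u t : C)).
    by move=> u; exact: (cvgD (cc s u) (cc t u)).
  by move=> u [uv _]; exact: (val_D uv s t).
- move=> s t; apply: (cl [set u : P | u (TMul s t) = u s * u t]).
    exact: (closed_eq_fun (cc (TMul s t)) (cM _ _ (cc s) (cc t))).
  by move=> u [uv _]; exact: (val_M uv s t).
- move=> t; apply: (cl [set u : P | u (TSqrt t) ^+ 2 = u t]).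
    exact: (closed_eq_fun (cM _ _ (cc (TSqrt t)) (cc (TSqrt t))) (cc t)).
  by move=> u [uv _]; exact: (val_sqrt uv t).
- move=> j; apply: (cl [set u : P | u (TInv j) * (p j).[(u TW)%:P].[u TZ] = 1]).
    exact: (closed_eq_fun (cM _ _ (cc (TInv j)) (cp j)) (ct 1)).
  by move=> u [uv _]; exact: (val_inv uv j).
- move=> j; apply: (cl [set u : P | e j <= nm (p j).[(u TW)%:P].[u TZ]]).
    exact: (closed_nm_ge (cp j)).
  by move=> u [uv _]; exact: (val_ge uv j).
- apply: (cl [set u : P | nm (u TZ) <= 1]); first exact: (closed_nm_le (cc TZ)).
  by move=> u [uv _]; exact: (val_Z uv).
- apply: (cl [set u : P | nm (u TW) <= 1]); first exact: (closed_nm_le (cc TW)).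
  by move=> u [uv _]; exact: (val_W uv).
move=> t M bM; apply: (cl [set u : P | nm (u t) <= M]); first exact: (closed_nm_le (cc t)).
by move=> u [_ uh]; exact: uh.
Qed.

(** Every coordinate is bounded uniformly over all valuations, so Tychonoff gives a pointwise
    cluster point, which is in the hull by closedness. *)
Lemma compact_hull : compact [set: hull_point].
Proof.
have /choice[bnd bndP] : forall t, exists M : R, forall v, valuation p e v -> nm (v t) <= M.
  by move=> t; have [M _ tM] := @val_bound R p e t e_gt0; exists M.
have cK := @tychonoff term (fun _ => C) (fun t => [set z : C | nm z <= bnd t])
  (fun t => @compact_disc R (bnd t)).
move=> F FF _.
have GK : (hull_val @ F) [set v : P | forall t, nm (v t) <= bnd t].
  by apply: (filterS (F := F) _ filterT) => x _ t; have [xv _] := hull_valP x; exact: (bndP t _ xv).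
have [v [_ clv]] := cK _ _ GK.
have hv : in_hull v.
  apply: closed_in_hull => E cE hE; apply: cE => U Uv.
  apply: clv Uv; apply: (filterS (F := F) _ filterT) => x _.
  exact: hE (hull_valP x).
exists (HullPoint hv); split=> // S U FS Ux.
have [d d0 dU] : exists2 d : R, 0 < d & forall y, hull_dist (HullPoint hv) y < d -> U y.
  move: Ux => /nbhs_ballP[d d0 dU]; exists d; first exact: d0.
  by move=> y yd; apply: (dU y); rewrite ballEmdist.
(* Terms of code at least n contribute less than d / 2 by their weight, which leaves finitely many
   coordinates to control. *)
have [n nd] : exists n, (1 / 2) ^+ n < d / 2.
  by apply: exists_expr_lt; [lra|rewrite divr_gt0].
have d2 : 0 < d / 2 by rewrite divr_gt0.
have [_ [[y Sy <-] yv]] := clv (hull_val @` S) _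
  (filterS (fun x Sx => ex_intro2 _ _ x Sx erefl) FS : (hull_val @ F) _) (near_coords v n d2).
exists y; split=> //; apply: dU.
apply: (@le_lt_trans _ _ (d / 2)); last by lra.
apply: hull_dist_le => t; rewrite /coord_dist /=.
have [tn|tn] := ltnP (pickle t) n.
  have := yv t tn => /ltW h; apply: le_trans h.
  apply: (@le_trans _ _ (Num.min 1 (nm (v t - y t)))).
    by rewrite ler_piMl ?weight_le1 // le_min ler01 nm_ge0.
  by rewrite ge_min lexx orbT.
apply: le_trans (ltW nd); rewrite -[leRHS]mulr1 ler_pM ?(ltW (weight_gt0 t)) //.
- by rewrite le_min ler01 nm_ge0.
- by rewrite /weight ler_wiXn2l //; lra.
- by rewrite ge_min lexx.
Qed.

End HullSpace.

(** * The uniform algebra generated by the terms on the hull *)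

Section HullAlgebra.
Variables (R : realType) (e : nat -> R).
Hypothesis e_gt0 : forall j, 0 < e j.
Local Notation C := (R[i]^o).
Local Notation p := (@base_poly R).
Local Notation X := (hull_point e).

Definition hull_ev (x : X) : term -> R[i] := x.

Lemma hull_evP x : valuation p e (hull_ev x).
Proof. exact: (hull_valP x).1. Qed.

Definition hull_pred : {pred X -> C} := fun f => `[< approx hull_ev xpredT f >].

Lemma hull_predP (f : X -> C) : reflect (approx hull_ev xpredT f) (f \in hull_pred).
Proof. exact: asboolP. Qed.

Let cs := term_closed_subalgebra e_gt0 hull_evP.

Lemma hull_one : 1 \in hull_pred.
Proof. by apply/hull_predP; exact: (cs_cst cs 1). Qed.

Lemma hull_linear : GRing.linear_closed hull_pred.
Proof.
move=> a f g /hull_predP Af /hull_predP Ag.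
by apply/hull_predP; exact: (cs_add cs (cs_mul cs (cs_cst cs a) Af) Ag).
Qed.

Lemma hull_mul : GRing.mulr_2closed hull_pred.
Proof.
by move=> f g /hull_predP Af /hull_predP Ag; apply/hull_predP; exact: (cs_mul cs Af Ag).
Qed.

Lemma hull_continuous (f : X -> C) : f \in hull_pred -> continuous f.
Proof.
move=> /hull_predP Af x; have FF : Filter (nbhs x) by exact: nbhs_filter.
apply: nm_cvgP => d d0.
have d3 : 0 < d / 3 by rewrite divr_gt0.
have [t _ ft] := Af _ d3; apply: filterS (near_coord x t d3) => y /= xy.
have := nm_triangle (x t) (f x) (f y); have := nm_triangle (y t) (x t) (f y).
have := ft x; have := ft y; rewrite (nm_dist (f y)) /hull_ev; lra.
Qed.

Lemma hull_separates (x y : X) : x <> y -> exists2 f, f \in hull_pred & f x <> f y.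
Proof.
move=> xy; have [t xyt] : exists t, x t <> y t.
  apply: contrapT => h; apply: xy; apply: hull_point_eq => t.
  by apply: contrapT => xyt; apply: h; exists t.
exists (fun x : X => x t) => //; apply/hull_predP.
exact: (@approx_term R X hull_ev xpredT t isT).
Qed.

Lemma hull_closed : closed ([set f | f \in hull_pred] : set {uniform X -> C}).
Proof.
apply/closed_uniformP => f fh; apply/hull_predP; apply: (cs_closed cs) => d d0.
by have [g /hull_predP Ag fg] := fh d d0; exists g.
Qed.

Definition hull_algebra : uniform_algebra R X :=
  UniformAlgebra hull_one hull_linear hull_mul hull_continuous hull_separates hull_closed.

Lemma hull_dense_invertible : dense (invertible hull_algebra).
Proof.
move=> U [f Uf] oU.
have : nbhs f U by exact: open_nbhs_nbhs.
move=> [V [[W oW WV] Vf VU]].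
have : nbhs (f : {uniform X -> C}) W by apply: open_nbhs_nbhs; split=> //; rewrite -WV in Vf.
move=> /uniform_nbhs_nm[d d0 dW].
have /hull_predP Af := valP f.
have [g [Ag [u Au ug] fg]] := term_dense_invertibles e_gt0 hull_evP Af d0.
have Ag' : g \in hull_pred by apply/hull_predP.
have Au' : u \in hull_pred by apply/hull_predP.
exists (UAType (A := hull_algebra) Ag'); split.
  by apply: VU; rewrite -WV; exact: dW.
exists (UAType (A := hull_algebra) Au'); apply/val_inj/funext => x.
exact: (etrans (mulrC (g x) (u x)) (ug x)).
Qed.

Definition hull_boundary : set X := [set x | nm (x TZ) = 1 \/ nm (x TW) = 1].

Lemma coord_continuous t : continuous (fun x : X => x t : C).
Proof.
move=> x; have FF : Filter (nbhs x) by exact: nbhs_filter.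
by apply: nm_cvgP => d d0; exact: near_coord.
Qed.

(** For terms the bound is the definition of the hull, boundary valuations being points of the hull
    themselves; uniform approximation extends it to the algebra. *)
Lemma hull_boundaryP : closed hull_boundary /\ maximum_set hull_algebra hull_boundary.
Proof.
have nmc t : continuous (fun x : X => nm (x t)).
  move=> x; apply: (continuous_comp (f := fun x : X => x t : C) (g := @nm R : C -> R)).
    exact: coord_continuous.
  exact: nm_continuous.
split.
  have -> : hull_boundary = (fun x : X => nm (x TZ)) @^-1` [set r | r = 1] `|`
      (fun x : X => nm (x TW)) @^-1` [set r | r = 1] by [].
  by apply: closedU; apply: preimage_closed; try exact: closed_eq; move=> y _; exact: nmc.
move=> f /hull_predP Af M fM x; apply/ler_addgt0Pl => d d0.
have d2 : 0 < d / 2 by rewrite divr_gt0.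
have [t _ ft] := Af _ d2.
have : nm (x t) <= M + d / 2.
  apply: (hull_valP x).2 => b bb.
  have hb : in_hull e b by split; [exact: bb.1|move=> s N; apply].
  have := fM (HullPoint hb) bb.2; have := ft (HullPoint hb); rewrite /hull_ev /=.
  have := nm_triangle (f (HullPoint hb)) (b t) 0; rewrite !subr0 nm_dist; lra.
have := ft x; have := nm_triangle (x t) (f x) 0; rewrite !subr0 /hull_ev; lra.
Qed.

End HullAlgebra.

Theorem theorem1p3 (R : realType) :
  exists (X : metricType R) (A : uniform_algebra R X) (G : set X),
    compact [set: X] /\ [set: X] !=set0 /\
    (forall phi, character_space A phi -> gleason_part A phi = [set phi]) /\
    dense (invertible A) /\
    is_shilov_boundary A G /\
    [set evaluation A x | x in G] <> character_space A.
Proof.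
have [e e_gt0 peaked] := peaked_thresholds (@base_poly_neq0 R).
(* A point over (0, 0) with principal roots; the p_j are large enough there by [threshold_at0]. *)
pose v0 := extend (@base_poly R) 0 0 (fun _ => sqrtC).
have v0v : valuation (@base_poly R) e v0.
  apply: valuation_extend; rewrite ?nm0 ?ler01 //.
    exact: threshold_at0 peaked.
  by move=> _ x; exact: sqrtCK.
have v0h : in_hull e v0.
  split=> // t M bM; have [L wL Lt] := over_tower t.
  exact: (fibre_hull e_gt0 peaked wL Lt v0v).
pose x0 : hull_point e := HullPoint v0h.
have cX := compact_hull e_gt0.
have X0 : [set: hull_point e] !=set0 by exists x0.
pose A := hull_algebra e_gt0.
have [G GA] := shilov_boundary_exists A cX X0.
exists (hull_point e), A, G; do 2!split=> //; split.
  move=> phi; apply: gleason_part_singleton => // f /hull_predP Af d d0.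
  have [h Ah fh] := term_dense_squares (hull_evP (e := e)) Af d0.
  by exists h => //; apply/hull_predP.
split; first exact: hull_dense_invertible.
split=> // GE.
(* If evaluation at x0 came from a point of G, separation would make that point x0 itself; but G
   lies over the boundary of the bidisc and both coordinates of x0 are 0. *)
have : character_space A (evaluation A x0) by exact: evaluation_character.
rewrite -GE => -[x Gx xx0].
have : hull_boundary x.
  by apply: GA.2 Gx; apply/is_boundaryP => //; exact: hull_boundaryP.
have -> : x = x0.
  apply: contrapT => /(ua_separates A)[f Af]; apply.
  by have := congr1 (fun phi => phi (UAType Af)) xx0.
by rewrite /hull_boundary /= /v0 /= nm0 => -[] /eqP; rewrite eq_sym oner_eq0.
Qed.
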